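(* Let $\mathbb K$ be an algebraically closed field of characteristic different from $2$ and $3$. Let $n,k\in\mathbb N$ be such that $n\ge2$, $k\ge3$ and $(n,k)\neq(2,3)$, and let $F\in\mathbb K\langle x_1,\dots,x_n\rangle$ be a cyclicly invariant element (not necessarily homogeneous) whose homogeneous components satisfy $F_0=\dots=F_{k-1}=0$. Then the potential algebra $A_F$ is infinite dimensional. Furthermore, if $(n,k)=(2,4)$ or $(n,k)=(3,3)$, then $A_F$ has at least cubic growth, and cubic growth is possible in both of these cases (i.e. is attained by some such $F$). For all other pairs, that is, for all $(n,k)$ with $n\ge2$, $k\ge3$ and $(n,k)\notin\{(2,3),(2,4),(3,3)\}$, $A_F$ has exponential growth.
   Context: Let $C$ be the linear map on the free algebra $\mathbb K\langle x_1,\dots,x_n\rangle$ with $C(1)=1$ and $C(x_ju)=ux_j$ for all monomials $u$. An element $F$ is cyclicly invariant if $C(F)=F$. $F_m$ denotes the degree $m$ homogeneous component of $F$. $\delta_{x_j}$ is the linear map given on monomials by $\delta_{x_j}u=v$ if $u=x_jv$ and $0$ otherwise. The potential algebra is $A_F=\mathbb K\langle x_1,\dots,x_n\rangle/I$, where $I$ is the two-sided ideal generated by $\delta_{x_1}F,\dots,\delta_{x_n}F$. Growth: for an algebra $A$ generated by $x_1,\dots,x_n$, let $a_j$ be the dimension of the subspace of $A$ spanned by (the images of) non-commutative polynomials in $x_1,\dots,x_n$ of degree at most $j$. $A$ has polynomial growth of degree $m$ if $m=\lim_{j\to\infty}\frac{\ln a_j}{\ln j}<\infty$; cubic growth is the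 case $m=3$, and at least cubic growth means $\liminf_{j\to\infty}\frac{\ln a_j}{\ln j}\ge3$. $A$ has exponential growth if there is $c>1$ with $a_j\ge c^j$ for all $j$. *)

(* Defs.v *)
From HB Require Import structures.
From mathcomp Require Import all_boot all_order all_algebra.
From mathcomp Require Import all_classical all_reals.
From mathcomp Require Import finmap topology normedtype sequences exp.
(* The notations of monalg are incompatible with those of mathcomp-analysis. *)
From mathcomp Require Import -(notations) monalg.

Set Implicit Arguments.
Unset Strict Implicit.
Unset Printing Implicit Defensive.

Import Order.TTheory GRing.Theory Num.Theory.
Import numFieldNormedType.Exports.
Import numFieldTopology.Exports.

Local Open Scope classical_set_scope.
Local Open Scope ring_scope.
Local Open Scope quotient_scope.

Lemma malg_scalerAr (M : monomType) (K : comNzRingType) (c : K)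
  (f g : malg M K) : c *: (f * g) = f * (c *: g).
Proof.
have mkZ (b : K) u : c *: (mkmalgU u b : malg M K) = mkmalgU u (c * b).
  apply/malgP => u'; rewrite mcoeffZ !mcoeffU.
  by case: eqVneq => _ /=; rewrite ?mulr1n ?mulr0n ?mulr0.
rewrite (monalgE g) mulr_sumr !scaler_sumr mulr_sumr; apply: eq_bigr => w _.
rewrite (monalgE f) !mulr_suml scaler_sumr; apply: eq_bigr => v _.
by rewrite mkZ !malgM_def !fgmulUU mkZ mulrCA.
Qed.

Section FreeAlgebra.
Variables (K : fieldType) (n : nat).

Definition word := fmonom 'I_n.
Definition freeAlg := malg word K.

HB.instance Definition _ := MonomialDef.on word.
HB.instance Definition _ := GRing.Lalgebra.on freeAlg.

Definition monom (w : word) : freeAlg := mkmalgU w 1.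
Definition gen (i : 'I_n) : freeAlg := monom (fmu i).

Definition lin_ext (h : word -> freeAlg) (f : freeAlg) : freeAlg :=
  \sum_(w <- msupp f) mcoeff w f *: h w.

Definition cyc : freeAlg -> freeAlg :=
  lin_ext (fun w => monom (FMonom (rot 1 w))).

Definition cyclicly_invariant (f : freeAlg) : Prop := cyc f = f.

Definition delta (j : 'I_n) : freeAlg -> freeAlg :=
  lin_ext (fun w => if (w : seq 'I_n) is i :: v
                    then if i == j then monom (FMonom v) else 0
                    else 0).

Definition hom_comp (m : nat) (f : freeAlg) : freeAlg :=
  \sum_(w <- msupp f | fdeg w == m) mcoeff w f *: monom w.

Definition deg_le (j : nat) : set freeAlg :=
  [set f | forall w, w \in msupp f -> (fdeg w <= j)%N].

Lemma lin_extEw (D : {fset word}) h f : fsubset (msupp f) D ->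
  lin_ext h f = \sum_(w <- D) mcoeff w f *: h w.
Proof.
move=> sD; apply: big_fset_incl => // w _ wf.
by rewrite mcoeff_outdom // scale0r.
Qed.

Lemma lin_ext_is_linear h : linear (lin_ext h).
Proof.
move=> c f g; pose D := fsetU (msupp f) (msupp g).
have sf : fsubset (msupp f) D by exact: fsubsetUl.
have sg : fsubset (msupp g) D by exact: fsubsetUr.
have s : fsubset (msupp (c *: f + g)) D.
  by rewrite (fsubset_trans (msuppD_le _ _)) // fsetSU // msuppZ_le.
rewrite !(lin_extEw _ s) (lin_extEw _ sf) (lin_extEw _ sg).
rewrite scaler_sumr -big_split /=; apply: eq_bigr => w _.
by rewrite mcoeffD mcoeffZ scalerDl scalerA.
Qed.

HB.instance Definition _ h :=
  GRing.isLinear.Build K freeAlg freeAlg _ (lin_ext h) (lin_ext_is_linear h).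

Lemma lin_ext_monom h w : lin_ext h (monom w) = h w.
Proof.
by rewrite /lin_ext msuppU1 big_seq_fset1 mcoeffU1 eqxx scale1r.
Qed.

Lemma lin_ext_id f : lin_ext monom f = f.
Proof.
rewrite [RHS]monalgE; apply: eq_bigr => w _; apply/malgP => v.
by rewrite mcoeffZ !mcoeffU mulrnAr mulr1.
Qed.

Lemma monomM u v : monom u * monom v = monom (FMonom (u ++ v)).
Proof.
by rewrite /monom malgM_def fgmulUU mulr1 /mmul /= fmmulE.
Qed.

Lemma monom1 : monom (FMonom [::]) = 1.
Proof. by rewrite /monom -fmoneE. Qed.

Lemma cyc1 : cyc 1 = 1.
Proof. by rewrite -monom1 /cyc lin_ext_monom. Qed.

Lemma cyc_genM j u : cyc (gen j * monom u) = monom u * gen j.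
Proof. by rewrite /gen !monomM /cyc lin_ext_monom fmuE /= rot1_cons cats1. Qed.

Lemma delta_genM i j u :
  delta j (gen i * monom u) = if i == j then monom u else 0.
Proof. by rewrite /gen monomM /delta lin_ext_monom fmuE /= fmK. Qed.

Lemma delta1 j : delta j 1 = 0.
Proof. by rewrite -monom1 /delta lin_ext_monom. Qed.

Lemma mcoeff_hom_comp m f w :
  mcoeff w (hom_comp m f) = if fdeg w == m then mcoeff w f else 0.
Proof.
have -> : hom_comp m f = lin_ext (fun v => if fdeg v == m then monom v else 0) f.
  rewrite /hom_comp big_mkcond; apply: eq_bigr => v _.
  by case: ifP; rewrite ?scaler0.
rewrite /lin_ext raddf_sum /=.
under eq_bigr => v _ do
  rewrite mcoeffZ (fun_if (mcoeff w)) mcoeffU1 mcoeff0.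
have [wf|wf] := boolP (w \in msupp f).
  rewrite (big_fsetD1 w) //= eqxx big1_fset ?addr0; last first.
    move=> v; rewrite !inE => /andP[/negbTE vw _] _.
    by rewrite vw; case: ifP; rewrite mulr0.
  by case: ifP; rewrite ?mulr1 ?mulr0.
rewrite mcoeff_outdom // if_same big1_seq // => v /= vf.
have /negbTE -> : v != w by apply: contraNneq wf => <-.
by case: ifP; rewrite mulr0.
Qed.

HB.instance Definition _ :=
  GRing.Lalgebra_isAlgebra.Build K freeAlg (@malg_scalerAr word K).

End FreeAlgebra.

Section Dimension.
Variables (K : fieldType) (V : lmodType K).

Definition lin_indep (d : nat) (e : 'I_d -> V) : Prop :=
  forall c : 'I_d -> K, \sum_i c i *: e i = 0 -> forall i, c i = 0.

Definition spans (d : nat) (e : 'I_d -> V) (U : set V) : Prop :=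
  U = [set v | exists c : 'I_d -> K, v = \sum_i c i *: e i].

Definition has_dim (U : set V) (d : nat) : Prop :=
  exists e : 'I_d -> V, lin_indep e /\ spans e U.

Definition finite_dim (U : set V) : Prop := exists d, has_dim U d.

(* Meaningful only when U is a finite-dimensional subspace (junk value 0
   otherwise); see has_dim_dim. *)
Definition dim (U : set V) : nat := xget 0%N [set d | has_dim U d].

Lemma has_dim_le (U : set V) d1 d2 :
  has_dim U d1 -> has_dim U d2 -> (d1 <= d2)%N.
Proof.
move=> [e [free_e]]; rewrite /spans => Ue [f [_]]; rewrite /spans => Uf.
have /choice[M eM] (i : 'I_d1) : exists c : 'I_d2 -> K, e i = \sum_j c j *: f j.
  have : U (e i).
    rewrite Ue /=; exists (fun j => (j == i)%:R).
    rewrite (bigD1 i) //= eqxx scale1r big1 ?addr0 // => j /negbTE ->.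
    by rewrite scale0r.
  by rewrite {1}Uf.
pose A : 'M[K]_(d1, d2) := \matrix_(i, j) M i j.
suff : row_free A by move=> /eqP <-; exact: rank_leq_col.
rewrite -kermx_eq0; apply/rowV0P => u /sub_kermxP uA.
apply/rowP => i; rewrite mxE.
apply: (free_e (fun i => u ord0 i)).
under eq_bigr => j _ do rewrite eM scaler_sumr.
rewrite exchange_big big1 //= => j _.
under eq_bigr => k _ do rewrite scalerA.
have := congr1 (fun B : 'rV_d2 => B ord0 j) uA; rewrite !mxE => h.
rewrite -scaler_suml -[RHS](scale0r (f j)); congr (_ *: _).
by rewrite -[RHS]h; apply: eq_bigr => k _; rewrite mxE.
Qed.

Lemma has_dim_dim (U : set V) : finite_dim U -> has_dim U (dim U).
Proof. exact: xgetPex. Qed.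

Lemma dimE (U : set V) d : has_dim U d -> dim U = d.
Proof.
move=> Ud; apply: xget_unique => // d' Ud'.
by apply/eqP; rewrite eqn_leq !(has_dim_le (U := U)).
Qed.

Lemma finite_dim_span m (s : 'I_m -> V) (U : set V) : spans s U -> finite_dim U.
Proof.
elim/ltn_ind: m s => m IH s Us.
have [free_s|] := pselect (lin_indep s); first by exists m, s.
case: m IH s Us => [IH s _|m IH s Us].
  by case; move=> c _ [].
move=> /existsNP[c] /not_implyP[c0] /existsNP[i /eqP ci].
apply: (IH m _ (fun j => s (lift i j))) => //.
rewrite /spans Us; apply/seteqP; split => v /= [b ->]; last first.
  exists (fun k => if unlift i k is Some j then b j else 0).
  rewrite (bigD1_ord i) //= unlift_none scale0r add0r.
  by apply: eq_bigr => j _; rewrite liftK.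
exists (fun j => b (lift i j) - b i / c i * c (lift i j)).
have si : s i = - \sum_j (c (lift i j) / c i) *: s (lift i j).
  move: c0; rewrite (bigD1_ord i) //= => /eqP; rewrite addr_eq0 => /eqP h.
  rewrite -[LHS]scale1r -(mulVf ci) -scalerA h scalerN scaler_sumr.
  by congr (- _); apply: eq_bigr => j _; rewrite scalerA mulrC.
rewrite (bigD1_ord i) //= si scalerN scaler_sumr addrC -sumrB.
apply: eq_bigr => j _; rewrite scalerA scalerBl; congr (_ - _ *: _).
by rewrite mulrA mulrAC.
Qed.

End Dimension.

Definition two_sided_ideal (A : pzRingType) (J : set A) : Prop :=
  [/\ J 0, forall x y, J x -> J y -> J (x - y),
      forall a x, J x -> J (a * x) & forall a x, J x -> J (x * a)].

Lemma smallest_ideal (A : pzRingType) (G : set A) :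
  two_sided_ideal (smallest (@two_sided_ideal A) G).
Proof.
split=> [J [[]]//|x y Jx Jy J JG|a x Jx J JG|a x Jx J JG].
- by case: (JG) => -[_ JB _ _] _; apply: JB; [apply: Jx|apply: Jy].
- by case: (JG) => -[_ _ JM _] _; apply: JM; apply: Jx.
- by case: (JG) => -[_ _ _ JM] _; apply: JM; apply: Jx.
Qed.

Section PotentialAlgebra.
Variables (K : fieldType) (n : nat) (F : freeAlg K n).

Definition pot_ideal : set (freeAlg K n) :=
  smallest (@two_sided_ideal _) (range (fun j => delta j F)).

Definition pot_ideal_pred : {pred freeAlg K n} := fun f => `[< pot_ideal f >].

Lemma pot_idealP f : reflect (pot_ideal f) (f \in pot_ideal_pred).
Proof. exact: asboolP. Qed.

Lemma pot_ideal_two_sided : two_sided_ideal pot_ideal.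
Proof. exact: smallest_ideal. Qed.

Lemma pot_ideal_zmod_closed : zmod_closed pot_ideal_pred.
Proof.
have [J0 JB _ _] := pot_ideal_two_sided.
split=> [|f g /pot_idealP Jf /pot_idealP Jg]; apply/pot_idealP => //.
exact: JB.
Qed.

HB.instance Definition _ :=
  GRing.isZmodClosed.Build _ pot_ideal_pred pot_ideal_zmod_closed.

Definition potAlg := Quotient.quot pot_ideal_pred.

HB.instance Definition _ := GRing.Zmodule.on potAlg.
HB.instance Definition _ := EqQuotient.on potAlg.

Definition pot_pi : freeAlg K n -> potAlg := \pi_potAlg.

Lemma pot_piP f g : pot_pi f = pot_pi g <-> pot_ideal (f - g).
Proof.
split => h; first by apply/pot_idealP; rewrite Quotient.idealrBE; apply/eqP.
by apply/eqP; rewrite -Quotient.idealrBE; apply/pot_idealP.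
Qed.

Lemma pot_pi_surj (a : potAlg) : exists f, pot_pi f = a.
Proof. by exists (repr a); rewrite /pot_pi reprK. Qed.

Lemma pot_pi_zmod : zmod_morphism pot_pi.
Proof. exact: pi_is_zmod_morphism. Qed.

HB.instance Definition _ :=
  GRing.isZmodMorphism.Build _ _ pot_pi pot_pi_zmod.

Lemma pot_piD f g : pot_pi (f + g) = pot_pi f + pot_pi g.
Proof. exact: raddfD. Qed.

Definition pot_one : potAlg := pot_pi 1.
Definition pot_mul (a b : potAlg) : potAlg :=
  locked pot_pi (repr a * repr b).
Definition pot_scale (c : K) (a : potAlg) : potAlg :=
  locked pot_pi (c *: repr a).

Lemma pot_repr f : pot_ideal (repr (pot_pi f) - f).
Proof. by apply/pot_piP; rewrite /pot_pi reprK. Qed.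

Lemma pot_piM f g : pot_mul (pot_pi f) (pot_pi g) = pot_pi (f * g).
Proof.
have [J0 JB JMl JMr] := pot_ideal_two_sided.
rewrite /pot_mul -lock; apply/pot_piP; set f' := repr _; set g' := repr _.
have -> : f' * g' - f * g = f' * (g' - g) - (f - f') * g.
  by rewrite mulrBr mulrBl opprB addrA addrNK.
apply: (JB _ _ (JMl _ _ (pot_repr g))); apply: (JMr).
have -> : f - f' = 0 - (f' - f) by rewrite sub0r opprB.
exact: (JB _ _ J0 (pot_repr f)).
Qed.

Lemma pot_piZ c f : pot_scale c (pot_pi f) = pot_pi (c *: f).
Proof.
have [_ _ JMl _] := pot_ideal_two_sided.
rewrite /pot_scale -lock; apply/pot_piP; rewrite -scalerBr -mul_malgC.
exact: (JMl _ _ (pot_repr f)).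
Qed.

Lemma pot_mulA : associative pot_mul.
Proof.
move=> a b c; have [f <-] := pot_pi_surj a; have [g <-] := pot_pi_surj b.
by have [h <-] := pot_pi_surj c; rewrite !pot_piM mulrA.
Qed.
Lemma pot_mul1 : left_id pot_one pot_mul.
Proof. by move=> a; have [f <-] := pot_pi_surj a; rewrite pot_piM mul1r. Qed.
Lemma pot_mulr1 : right_id pot_one pot_mul.
Proof. by move=> a; have [f <-] := pot_pi_surj a; rewrite pot_piM mulr1. Qed.
Lemma pot_mulDl : left_distributive pot_mul +%R.
Proof.
move=> a b c; have [f <-] := pot_pi_surj a; have [g <-] := pot_pi_surj b.
have [h <-] := pot_pi_surj c.
by rewrite -pot_piD !pot_piM mulrDl pot_piD.
Qed.
Lemma pot_mulDr : right_distributive pot_mul +%R.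
Proof.
move=> a b c; have [f <-] := pot_pi_surj a; have [g <-] := pot_pi_surj b.
have [h <-] := pot_pi_surj c.
by rewrite -pot_piD !pot_piM mulrDr pot_piD.
Qed.

(* potAlg is only a possibly trivial ring (an lmodType and a pzRingType):
   MathComp algebras are nontrivial, and 1 may be in pot_ideal when F has a
   homogeneous component of degree 1. *)
HB.instance Definition _ := GRing.Zmodule_isPzRing.Build potAlg
  pot_mulA pot_mul1 pot_mulr1 pot_mulDl pot_mulDr.

Lemma pot_scaleA b c (a : potAlg) :
  pot_scale b (pot_scale c a) = pot_scale (b * c) a.
Proof. by have [f <-] := pot_pi_surj a; rewrite !pot_piZ scalerA. Qed.
Lemma pot_scale1 : left_id 1 pot_scale.
Proof. by move=> a; have [f <-] := pot_pi_surj a; rewrite pot_piZ scale1r. Qed.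
Lemma pot_scaleDr : right_distributive pot_scale +%R.
Proof.
move=> c a b; have [f <-] := pot_pi_surj a; have [g <-] := pot_pi_surj b.
by rewrite -pot_piD !pot_piZ -pot_piD scalerDr.
Qed.
Lemma pot_scaleDl (a : potAlg) : {morph pot_scale^~ a : b c / b + c}.
Proof.
move=> b c; have [f <-] := pot_pi_surj a.
by rewrite !pot_piZ -pot_piD scalerDl.
Qed.

HB.instance Definition _ := GRing.Zmodule_isLmodule.Build K potAlg
  pot_scaleA pot_scale1 pot_scaleDr pot_scaleDl.

Lemma pot_pi_monoid : monoid_morphism pot_pi.
Proof. by split=> [|f g]; [exact: erefl | exact: esym (pot_piM f g)]. Qed.
HB.instance Definition _ :=
  GRing.isMonoidMorphism.Build _ _ pot_pi pot_pi_monoid.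

Lemma pot_pi_scalable : scalable pot_pi.
Proof. by move=> c f; rewrite -pot_piZ. Qed.
HB.instance Definition _ :=
  GRing.isScalable.Build K _ _ _ pot_pi pot_pi_scalable.

Lemma pot_scaleAl c (a b : potAlg) : c *: (a * b) = (c *: a) * b.
Proof.
have [f <-] := pot_pi_surj a; have [g <-] := pot_pi_surj b.
by rewrite -rmorphM -!linearZ -rmorphM /= -scalerAl.
Qed.
Lemma pot_scaleAr c (a b : potAlg) : c *: (a * b) = a * (c *: b).
Proof.
have [f <-] := pot_pi_surj a; have [g <-] := pot_pi_surj b.
by rewrite -rmorphM -!linearZ -rmorphM /= -scalerAr.
Qed.

Definition filtration (j : nat) : set potAlg := pot_pi @` @deg_le K n j.

Definition growth (j : nat) : nat := dim (filtration j).

Lemma finite_dim_filtration j : finite_dim (filtration j).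
Proof.
pose s := flatten [seq [seq FMonom (tval t) | t <- enum {: i.-tuple 'I_n}]
                  | i <- iota 0 j.+1].
pose D : {fset word n} := seq_fset tt s.
have inD w : (w \in D) = (fdeg w <= j)%N.
  rewrite seq_fsetE; apply/flatten_mapP/idP => [[i]|wj].
    by rewrite mem_iota => /andP[_ ij] /mapP[t _ ->]; rewrite /fdeg size_tuple.
  exists (fdeg w); first by rewrite mem_iota.
  by apply/mapP; exists (in_tuple w); rewrite ?mem_enum //= fmK.
pose e (i : 'I_(size D)) := nth (FMonom [::]) D i.
apply: (@finite_dim_span _ _ _ (fun i => pot_pi (monom K (e i)))).
apply/seteqP; split => [_ [f fj <-]|_ [c ->]] /=.
  have fD : fsubset (msupp f) D by apply/fsubsetP => w /fj; rewrite inD.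
  exists (fun i => mcoeff (e i) f); rewrite -[in LHS](lin_ext_id f).
  rewrite (lin_extEw _ fD) (big_nth (FMonom [::])) big_mkord raddf_sum.
  by apply: eq_bigr => i _; rewrite /= linearZ.
exists (\sum_i c i *: monom K (e i)); last first.
  by rewrite raddf_sum; apply: eq_bigr => i _; rewrite /= linearZ.
move=> w; apply: contraTT; rewrite -mcoeff_eq0 => jw.
rewrite raddf_sum big1 // => i _; rewrite /= mcoeffZ mcoeffU1.
case: eqVneq => [ew|_]; last by rewrite mulr0.
by move: jw; rewrite -ew -inD mem_nth.
Qed.

Lemma growthP j : has_dim (filtration j) (growth j).
Proof. exact/has_dim_dim/finite_dim_filtration. Qed.

End PotentialAlgebra.

Section Growth.
Variables (R : realType) (a : nat -> nat).

(* The junk values at j = 0, 1 do not affect limits as j -> oo. *)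
Definition growth_ratio (j : nat) : R := ln (a j)%:R / ln j%:R.

Definition polynomial_growth (m : R) : Prop := growth_ratio @ \oo --> m.

Definition cubic_growth : Prop := polynomial_growth 3.

Definition at_least_cubic_growth : Prop :=
  (3%:E <= limn_einf (fun j => (growth_ratio j)%:E))%E.

Definition exponential_growth : Prop :=
  exists2 c : R, 1 < c & forall j, c ^+ j <= (a j)%:R.

End Growth.

(* Main.v *)
(* Every algebra A_F with F of order at least k dominates, degree by degree, the
   Hilbert series 1/(1 - n t + n t^(k-1) - t^k), divided by 1 - t.

   Work with the dual S_i of the quotient of the free algebra by the potential
   ideal and the words of length >= i.  A functional in S_(d+1) is a constant
   together with n functionals in S_d (restrict along the first letter)
   killed by the n maps f |-> f(r_j .), r_j = delta_j F.  Since
   sum x_j r_j = F = sum r_j x_j, these n values satisfy one linear relation;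
   if f |-> f(z .) is onto for some letter z that relation is independent, and
   we get the Golod-Shafarevich type recursion
     dim S_(d+1) >= 1 + n dim S_d - n dim S_(d-k+2) + dim S_(d-k+1).

   An explicit potential G, obtained from the cyclic orbits of x^(k-2) b b'
   (b |-> b' exchanging two letters), has relations whose leading words
   overlap just once, and their normal words have exactly the expected number;
   the last letter z begins no leading word, so multiplication by z preserves
   normal words.  Having maximal rank is an open condition, so on the line
   through F and G a generic potential H has a quotient no larger than that of F,
   while normal words still span its quotient.  By induction on the degree the
   normal words are then a basis for H, z is onto in dual form, and F inherits
   the lower bound.  The recursion finally gives exponential or cubic growth. *)
Require Import Defs.
From HB Require Import structures.
From mathcomp Require Import all_boot all_order all_algebra.
From mathcomp Require Import all_classical all_reals.
From mathcomp Require Import finmap topology normedtype sequences exp ereal.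
From mathcomp Require Import -(notations) monalg.
From mathcomp Require Import zify lra.

Set Implicit Arguments.
Unset Strict Implicit.
Unset Printing Implicit Defensive.

Import Order.TTheory GRing.Theory Num.Theory.
Import numFieldNormedType.Exports.
Import numFieldTopology.Exports.

Local Open Scope classical_set_scope.
Local Open Scope ring_scope.

(** * Linear algebra *)

Lemma rank_pencil_generic (K : fieldType) m p (A B : 'M[K]_(m, p)) (t0 : K) :
  exists2 P : {poly K}, P != 0 &
    forall t, ~~ root P t -> (\rank (A + t0 *: B)%R <= \rank (A + t *: B)%R)%N.
Proof.
(* P(t) is the determinant of a compression of A + t B of size \rank (A + t0 B)
   that is the identity at t0. *)
set M0 := A + t0 *: B; set r := \rank M0.
have /row_freeP[Q HQ] := row_base_free M0.
have /row_fullP[S HS] := col_base_full M0.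
pose N t := S *m (A + t *: B) *m Q.
pose NP := map_mx polyC (S *m A *m Q) + 'X *: map_mx polyC (S *m B *m Q).
have NPE t : map_mx (horner_eval t) NP = N t.
  have -> : N t = S *m A *m Q + t *: (S *m B *m Q).
    by rewrite /N mulmxDr mulmxDl -scalemxAr -scalemxAl.
  apply/matrixP => i j; rewrite /NP; move: (S *m A *m Q) (S *m B *m Q) => A' B'.
  by rewrite !mxE /horner_eval !hornerE.
have detE t : (\det NP).[t] = \det (N t).
  by rewrite -NPE det_map_mx.
exists (\det NP).
  apply/eqP => P0; have := detE t0; rewrite P0 horner0.
  have -> : N t0 = 1%:M.
    have /(congr1 (fun M => S *m M *m Q)) := mulmx_base M0.
    by rewrite mulmxA HS mul1mx HQ /N -/M0 => <-.
  by rewrite det1 => /eqP; rewrite eq_sym oner_eq0.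
move=> t; rewrite /root detE => dN.
have rN : \rank (N t) = r by apply: mxrank_unit; rewrite unitmxE unitfE.
rewrite -/M0 -/r -rN.
by rewrite (leq_trans (mxrankM_maxl _ _)) // mxrankM_maxr.
Qed.

Section VectorSpaces.
Variable K : fieldType.

(** A subspace of maximal dimension inside [P] is all of [P], since adjoining a vector of [P] stays
    in [P]. Annihilators can thus be given by predicates, without bases. *)
Lemma vspace_of_pred (V : vectType K) (P : V -> Prop) :
  P 0 -> (forall c u v, P u -> P v -> P (c *: u + v)) ->
  exists U : {vspace V}, forall v, v \in U <-> P v.
Proof.
move=> P0 PL.
pose good d :=
  `[< exists U : {vspace V}, (forall v, v \in U -> P v) /\ \dim U = d >].
have exg : exists d, good d.
  exists 0%N; apply/asboolP; exists 0%VS; split; last by rewrite dimv0.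
  by move=> v; rewrite memv0 => /eqP ->.
have ubg d : good d -> (d <= \dim {:V})%N.
  by move=> /asboolP[U [_ <-]]; apply: dimvS; apply: subvf.
case: (ex_maxnP exg ubg) => d /asboolP[U [UP dU]] maxd.
exists U => v; split=> [/UP //|Pv].
have /maxd : good (\dim (U + <[v]>)).
  apply/asboolP; exists (U + <[v]>)%VS; split=> // w.
  move=> /memv_addP[u uU [_ /vlineP[c ->] ->]].
  by rewrite addrC; apply: PL => //; apply: UP.
rewrite -dU => le; have := eqEdim U (U + <[v]>).
by rewrite addvSl le => /eqP ->; rewrite (subvP (addvSr _ _)) // memv_line.
Qed.

Lemma dimv_inj (V W : vectType K) (U : {vspace V}) (X : {vspace W})
    (f : {linear V -> W}) :
  (forall v, v \in U -> f v = 0 -> v = 0) ->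
  (forall v, v \in U -> f v \in X) -> (\dim U <= \dim X)%N.
Proof.
move=> finj fX; rewrite -(limg_dim_eq (f := linfun f) (U := U)).
  apply: dimvS; apply/subvP => w /memv_imgP[v vU ->].
  by rewrite lfunE; apply: fX.
apply/eqP; rewrite -subv0; apply/subvP => v.
rewrite memv_cap memv_ker lfunE /= => /andP[vU /eqP fv].
by rewrite (finj _ vU fv) mem0v.
Qed.

(** Rank-nullity for [f] on [U]: the image lies in [X], and [g] embeds the kernel into [X']. *)
Lemma dimv_ker_le (V W Y : vectType K) (U : {vspace V}) (X : {vspace W})
    (X' : {vspace Y}) (f : {linear V -> W}) (g : {linear V -> Y}) :
  (forall v, v \in U -> f v \in X) ->
  (forall v, v \in U -> f v = 0 -> g v \in X') ->
  (forall v, v \in U -> g v = 0 -> v = 0) ->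
  (\dim U <= \dim X + \dim X')%N.
Proof.
move=> fX gX ginj; rewrite -(limg_ker_dim (linfun f) U) addnC leq_add //.
  apply: dimvS; apply/subvP => w /memv_imgP[v vU ->].
  by rewrite lfunE; apply: fX.
apply: (dimv_inj (f := g)) => v; rewrite memv_cap memv_ker lfunE /=.
  by move=> /andP[vU _]; apply: ginj.
by move=> /andP[vU /eqP]; apply: gX.
Qed.

Lemma dimv_surj_ker (V W : vectType K) (U X : {vspace V}) (Y : {vspace W})
    (f : {linear V -> W}) :
  (forall v, v \in X -> v \in U /\ f v = 0) ->
  (forall w, w \in Y -> exists2 v, v \in U & f v = w) ->
  (\dim X + \dim Y <= \dim U)%N.
Proof.
move=> Xker Ysurj; rewrite -(limg_ker_dim (linfun f) U) leq_add //.
  apply: dimvS; apply/subvP => v /Xker[vU fv].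
  by rewrite memv_cap vU memv_ker lfunE /= fv eqxx.
apply: dimvS; apply/subvP => w /Ysurj[v vU <-].
by rewrite -(lfunE f) memv_img.
Qed.

Lemma dimv_pow (V : vectType K) n (U : {vspace V})
    (X : {vspace {ffun 'I_n -> V}}) :
  (forall g : {ffun 'I_n -> V}, g \in X <-> forall i, g i \in U) ->
  \dim X = (n * \dim U)%N.
Proof.
move=> XP.
pose h (g : {ffun 'I_n -> subvs_of U}) : {ffun 'I_n -> V} := [ffun i => vsval (g i)].
have hlin : linear h.
  by move=> c g1 g2; apply/ffunP => i; rewrite !ffunE linearP.
pose hL : {linear {ffun 'I_n -> subvs_of U} -> {ffun 'I_n -> V}} :=
  HB.pack h (GRing.isLinear.Build _ _ _ _ h hlin).
have -> : X = limg (linfun hL).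
  apply/vspaceP => g; apply/idP/idP.
    move=> /XP gU; apply/memv_imgP.
    exists [ffun i => vsproj U (g i)]; first exact: memvf.
    by rewrite lfunE; apply/ffunP => i; rewrite !ffunE vsprojK.
  move=> /memv_imgP[g' _ ->]; apply/XP => i.
  by rewrite lfunE ffunE subvsP.
rewrite limg_dim_eq ?dimvf; last first.
  apply/eqP; rewrite -subv0; apply/subvP => g.
  rewrite memv_cap memv_ker lfunE /= memvf /= memv0 => /eqP hg0.
  apply/eqP/ffunP => i; apply: subvs_inj.
  by have := congr1 (fun f : {ffun _ -> V} => f i) hg0; rewrite !ffunE linear0.
by rewrite {1}/dim /= card_ord.
Qed.

Lemma dimv_rV m : \dim {:'rV[K]_m} = m.
Proof. by rewrite dimvf dim_matrix; apply: mul1n. Qed.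

Lemma dimv_kermx q p (M : 'M[K]_(q, p)) (U : {vspace 'rV[K]_q}) :
  (forall f : 'rV[K]_q, f \in U <-> f *m M = 0) -> \dim U = (q - \rank M)%N.
Proof.
move=> UP; pose B := row_base (kermx M).
have -> : U = limg (linfun (mulmxr B : 'rV_(\rank (kermx M)) -> 'rV_q)).
  apply/vspaceP => f; apply/idP/idP.
    move=> /UP /sub_kermxP; rewrite -(eq_row_base (kermx M)) => /submxP[D ->].
    by apply/memv_imgP; exists D; rewrite ?memvf // lfunE.
  move=> /memv_imgP[D _ ->]; apply/UP/sub_kermxP.
  by rewrite lfunE /= -(eq_row_base (kermx M)) submxMl.
rewrite limg_dim_eq; last first.
  apply/eqP; rewrite -subv0; apply/subvP => D.
  rewrite memv_cap memv_ker lfunE /= memvf /= memv0 => /eqP DB.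
  have /row_freeP[C BC] := row_base_free (kermx M).
  by rewrite -(mulmx1 D) -BC mulmxA DB mul0mx.
by rewrite dimv_rV mxrank_ker.
Qed.

(** Independence of [e] forces the coordinate matrix to have full row rank. It is applied inside the
    potential algebra, which is only an [lmodType]. *)
Lemma lin_indep_le (V : lmodType K) d1 d2 (e : 'I_d1 -> V) (f : 'I_d2 -> V) :
  (forall c : 'I_d1 -> K, \sum_i c i *: e i = 0 -> forall i, c i = 0) ->
  (forall i, exists c : 'I_d2 -> K, e i = \sum_j c j *: f j) -> (d1 <= d2)%N.
Proof.
move=> free_e /choice[M eM].
pose A : 'M[K]_(d1, d2) := \matrix_(i, j) M i j.
suff : row_free A by move=> /eqP <-; exact: rank_leq_col.
rewrite -kermx_eq0; apply/rowV0P => u /sub_kermxP uA.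
apply/rowP => i; rewrite mxE; apply: (free_e (fun i => u ord0 i)).
under eq_bigr => j _ do rewrite eM scaler_sumr.
rewrite exchange_big big1 //= => j _.
have := congr1 (fun B : 'rV_d2 => B ord0 j) uA; rewrite !mxE => h.
rewrite -[RHS](scale0r (f j)) -[in RHS]h scaler_suml.
by apply: eq_bigr => k _; rewrite scalerA mxE.
Qed.
End VectorSpaces.

(** * Normal words *)

Section NormalWords.
Local Open Scope nat_scope.
(* There are n + 2 letters, and the potentials have order at least k = l + 3. *)
Variables n l : nat.
Local Notation letter := 'I_n.+2.

Definition lx : letter := ord0.
Definition ly : letter := lift ord0 ord0.
Definition lz : letter := ord_max.

(** Leading words of the model relators for the order x > y > ... > z, indexed so that [lead c]
    belongs to the relator of [swap c]. For n = 0 the letters y and z coincide. *)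
Definition lead (j : letter) : seq letter :=
  if j == lx then nseq l lx ++ [:: ly; lz] else rcons (nseq l.+1 lx) j.

Definition lead_prefix (w : seq letter) : bool :=
  [exists j, prefix (lead j) w].

Fixpoint normal (w : seq letter) : bool :=
  if w is _ :: v then ~~ lead_prefix w && normal v else true.

Fixpoint normal_words (i : nat) : seq (seq letter) :=
  if i is i'.+1 then
    [::] :: [seq w <- [seq a :: v | a <- enum 'I_n.+2, v <- normal_words i']
            | ~~ lead_prefix w]
  else [::].

Lemma mem_normal_words i w :
  (w \in normal_words i) = (size w < i) && normal w.
Proof.
elim: i w => [|i IH] [|a v] //=; rewrite in_cons /= mem_filter ltnS.
have -> : (a :: v \in [seq b :: u | b <- enum 'I_n.+2, u <- normal_words i])
   = (v \in normal_words i).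
  apply/allpairsP/idP => [[[b u] /= [_ uN [_ ->]]]//|vN].
  by exists (a, v); rewrite mem_enum.
by rewrite IH andbCA.
Qed.

Lemma uniq_normal_words i : uniq (normal_words i).
Proof.
elim: i => //= i IH; rewrite filter_uniq ?andbT; last first.
  apply: allpairs_uniq => //; first exact: enum_uniq.
  by move=> [a v] [b u] _ _ /= [-> ->].
by rewrite mem_filter negb_and; apply/orP; right; apply/allpairsP => -[[b u] []].
Qed.

Lemma size_lead j : size (lead j) = l.+2.
Proof.
by rewrite /lead; case: ifP => _; rewrite ?size_cat ?size_rcons size_nseq ?addn2.
Qed.

Hypothesis lpn_gt0 : 0 < l + n.

Lemma lead_neq_x j : j != lx -> lead j = nseq l lx ++ [:: lx; j].
Proof. by move=> /negbTE jx; rewrite /lead jx -cats1 -(addn1 l) nseqD -catA. Qed.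

Lemma leadx : lead lx = nseq l lx ++ [:: ly; lz].
Proof. by rewrite /lead eqxx. Qed.

Lemma lead_inj : injective lead.
Proof.
move=> i j; have [->|ix] := eqVneq i lx; have [->|jx] := eqVneq j lx => //.
- by rewrite leadx lead_neq_x // => /eqP; rewrite eqseq_cat // => /andP[_ /eqP[]].
- by rewrite leadx lead_neq_x // => /eqP; rewrite eqseq_cat // => /andP[_ /eqP[]].
by rewrite !lead_neq_x // => /eqP; rewrite eqseq_cat // => /andP[_ /eqP[]].
Qed.

(** Every leading word starts with x^l, so a letter other than x at position e <= l forces e = l,
    and then only x^l y z can match. *)
Lemma not_lead_prefix e a v : e <= l -> a != lx ->
  ~~ [&& e == l, a == ly & ohead v == Some lz] ->
  ~~ lead_prefix (nseq e lx ++ a :: v).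
Proof.
move=> el ax; apply: contra => /existsP[j /prefixP[w /= E]].
have nE := congr1 (fun s => nth lx s e) E.
rewrite nth_cat size_nseq ltnn subnn /= in nE.
have [jx|jx] := eqVneq j lx; last first.
  rewrite lead_neq_x // -catA nth_cat size_nseq in nE.
  move: nE; case: ltnP => [lt|ge]; first by rewrite nth_nseq lt => ax'; case/eqP: ax.
  have -> : e - l = 0 by lia.
  by move=> /= ax'; case/eqP: ax.
rewrite jx leadx -catA nth_cat size_nseq in nE E.
move: nE; case: ltnP => [lt|ge]; first by rewrite nth_nseq lt => ax'; case/eqP: ax.
have el' : e = l by lia.
move: E; rewrite el' => /eqP; rewrite eqseq_cat // => /andP[_ /eqP[-> ->]] _.
by rewrite !eqxx.
Qed.

(** No leading word begins with z: for l > 0 all begin with x, and for l = 0 they begin with x or y,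
    while n > 0 makes y and z distinct. This fails exactly for l = n = 0. *)
Lemma normal_lz w : normal (lz :: w) = normal w.
Proof.
suff : ~~ [&& 0 == l, lz == ly & ohead w == Some lz].
  by move=> h; rewrite /= (not_lead_prefix (e := 0) (a := lz) (v := w)).
rewrite -(inj_eq val_inj lz ly) /= /bump /=; apply/and3P => -[/eqP l0 /eqP n0 _].
lia.
Qed.

Lemma normal_pad e a v : e <= l -> a != lx ->
  (e < l) || ~~ [&& a == ly & ohead v == Some lz] -> normal (a :: v) ->
  normal (nseq e lx ++ a :: v).
Proof.
move=> el ax av Nv; elim: e el av => [|e IH] el av //.
rewrite [nseq _ _]/= [_ ++ _]/= [normal _]/= IH ?(ltnW el) ?el // andbT.
apply: (not_lead_prefix (e := e.+1)) => //.
by rewrite negb_and; apply/orP; case/orP: av => [lt|->]; [left; lia | right].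
Qed.

Lemma normal_cons_neq_x a v : a != lx -> normal v ->
  (0 < l) || ~~ [&& a == ly & ohead v == Some lz] -> normal (a :: v).
Proof.
move=> ax Nv av; rewrite /= Nv andbT; apply: (not_lead_prefix (e := 0)) => //.
by rewrite negb_and; apply/orP; case/orP: av => [lt|->]; [left; lia | right].
Qed.

(** The only overlap of leading words is x^(l+1) y with x^l y z, along x^l y. Unless it occurs, a
    leading word followed by a normal word has its first letter as sole obstruction to normality. *)
Lemma normal_behead_lead j v : normal v ->
  ~~ [&& j == ly & ohead v == Some lz] -> normal (behead (lead j ++ v)).
Proof.
move=> Nv jv; have [->|jx] := eqVneq j lx; last first.
  rewrite lead_neq_x //.
  have -> : nseq l lx ++ [:: lx; j] = nseq l.+1 lx ++ [:: j].
    by rewrite -(addn1 l) nseqD -catA.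
  rewrite /= -catA; apply: normal_pad; rewrite ?jv ?orbT //.
  by apply: normal_cons_neq_x; rewrite ?jv ?orbT.
rewrite leadx; have Nz : normal (lz :: v) by rewrite normal_lz.
have [l0|l0] := posnP l; first by rewrite l0.
rewrite -(prednK l0) /= -catA; apply: normal_pad; rewrite ?prednK ?leqnn ?leq_pred //.
by apply: normal_cons_neq_x; rewrite ?l0.
Qed.

(** Among the words a v with v normal, those that are not normal include all [lead j ++ v] with (j,
    v) outside [bad], and this map is injective. Only the upper bound on normal words is
    combinatorial; the reverse comes from dimensions in [size_normal_words_recE]. *)
Lemma size_normal_words_rec d :
  size (normal_words d.+1) + n.+2 * size (normal_words (d - l.+1))
    <= 1 + n.+2 * size (normal_words d) + size (normal_words (d - l.+2)).
Proof.
set W := normal_words (d - l.+1).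
set A := [seq a :: v | a <- enum 'I_n.+2, v <- normal_words d].
set Q := [seq (j, v) | j <- enum 'I_n.+2, v <- W].
(* Here [lead j ++ v] is x x^l y z v', which has a leading word at its second position; such a pair
   is determined by the normal word v'. *)
pose bad (jv : letter * seq letter) := (jv.1 == ly) && (ohead jv.2 == Some lz).
have memQ j v : ((j, v) \in Q) = (v \in W).
  apply/allpairsP/idP => [[[b u] /= [_ uN [_ ->]]]//|vN].
  by exists (j, v); rewrite mem_enum.
have uQ : uniq Q.
  apply: allpairs_uniq; [exact: enum_uniq|exact: uniq_normal_words|].
  by move=> [a v] [b u].
have sA : size A = n.+2 * size (normal_words d).
  by rewrite size_allpairs -cardE card_ord.
have sQ : size Q = n.+2 * size W by rewrite size_allpairs -cardE card_ord.
have sN : size (normal_words d.+1) = 1 + count (predC lead_prefix) A.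
  by rewrite /= size_filter.
have le1 : count bad Q <= size (normal_words (d - l.+2)).
  rewrite -size_filter -(size_map (fun jv => behead jv.2)) uniq_leq_size //.
    rewrite map_inj_in_uniq ?filter_uniq // => -[i [|a v]] [j [|b u]];
      rewrite !mem_filter /bad /= ?andbF // => /andP[/andP[/eqP -> /eqP[->]] _].
    by move=> /andP[/andP[/eqP -> /eqP[->]] _] ->.
  move=> w /mapP[[j [|a v]]]; rewrite mem_filter /bad /= ?andbF //.
  rewrite memQ => /andP[/andP[_ /eqP[->]]]; rewrite !mem_normal_words normal_lz.
  by move=> /andP[/= sv Nv] ->; rewrite Nv andbT; lia.
have le2 : count (predC bad) Q <= count lead_prefix A.
  rewrite -!size_filter -(size_map (fun jv => lead jv.1 ++ jv.2)) uniq_leq_size //.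
    rewrite map_inj_in_uniq ?filter_uniq // => -[i v] [j u] _ _ /= /eqP.
    by rewrite eqseq_cat ?size_lead // => /andP[/eqP/lead_inj -> /eqP ->].
  move=> w /mapP[[j v]]; rewrite !mem_filter memQ mem_normal_words.
  move=> /andP[/= jv /andP[sv Nv]] ->.
  have Nb := normal_behead_lead Nv jv.
  have := size_lead j; case E: (lead j) => [//|a s] /= [ss].
  apply/andP; split; first by apply/existsP; exists j;
    rewrite E -cat_cons prefix_prefix.
  apply/allpairsP; exists (a, s ++ v); split; rewrite ?mem_enum //=.
  move: Nb; rewrite E /= mem_normal_words => ->; rewrite size_cat andbT ss.
  by move: sv; rewrite ltn_subRL => sv; apply: leq_trans sv; rewrite ltnS.
have := count_predC bad Q; have := count_predC lead_prefix A.
by rewrite sA sQ sN; lia.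
Qed.

Lemma size_normal_wordsS d :
  size (normal_words d.+1) <= 1 + n.+2 * size (normal_words d).
Proof.
rewrite /= size_filter add1n ltnS; apply: leq_trans (count_size _ _) _.
by rewrite size_allpairs -cardE card_ord.
Qed.

End NormalWords.

(** * The free algebra and its truncated dual *)

Section FreeAlgebraExtra.
Variables (K : fieldType) (n : nat).
Implicit Types p q : freeAlg K n.
Local Notation mon w := (@monom K n (FMonom w)).
Local Notation gen := (@gen K n).

Lemma freeAlgE p : p = \sum_(w <- msupp p) mcoeff w p *: mon w.
Proof. by rewrite -[LHS]lin_ext_id; apply: eq_bigr => w _; rewrite fmK. Qed.

Lemma mcoeff_monom (u w : word n) :
  mcoeff w (monom K u) = (u == w)%:R.
Proof. by rewrite mcoeffU1. Qed.

Lemma monom_cons i w : mon (i :: w) = gen i * mon w.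
Proof. by rewrite /gen monomM fmuE. Qed.

Lemma mulr_expand p q : p * q = \sum_(w <- msupp q) mcoeff w q *: (p * mon w).
Proof.
by rewrite {1}(freeAlgE q) mulr_sumr; apply: eq_bigr => w _; rewrite scalerAr.
Qed.

Lemma mull_expand p q : p * q = \sum_(w <- msupp p) mcoeff w p *: (mon w * q).
Proof.
by rewrite {1}(freeAlgE p) mulr_suml; apply: eq_bigr => w _; rewrite scalerAl.
Qed.

Definition order_ge m p := forall w : word n, (size w < m)%N -> mcoeff w p = 0.

Lemma order_geD m p q : order_ge m p -> order_ge m q -> order_ge m (p + q).
Proof. by move=> hp hq w wm; rewrite mcoeffD hp // hq // addr0. Qed.

Lemma order_geZ m c p : order_ge m p -> order_ge m (c *: p).
Proof. by move=> hp w wm; rewrite mcoeffZ hp // mulr0. Qed.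

Lemma order_ge0 m : order_ge m (0 : freeAlg K n).
Proof. by move=> w _; rewrite mcoeff0. Qed.

Lemma order_ge_sum m (I : Type) (r : seq I) (P : pred I) (E : I -> freeAlg K n) :
  (forall i, P i -> order_ge m (E i)) -> order_ge m (\sum_(i <- r | P i) E i).
Proof.
move=> hE; elim/big_rec: _ => [|i x Pi hx]; first exact: order_ge0.
by apply: order_geD => //; apply: hE.
Qed.

Lemma order_ge_monom m (w : word n) : (m <= size w)%N -> order_ge m (monom K w).
Proof.
move=> mw u um; rewrite mcoeff_monom; case: eqP => // wu.
by rewrite wu leqNgt um in mw.
Qed.

Lemma order_ge_leq m m' p : (m' <= m)%N -> order_ge m p -> order_ge m' p.
Proof. by move=> le hp w wm; apply: hp; apply: leq_trans wm le. Qed.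

Lemma order_ge_msupp m p (w : word n) :
  order_ge m p -> w \in msupp p -> (m <= size w)%N.
Proof.
by move=> hp; rewrite -mcoeff_neq0 leqNgt; apply: contra => wm; rewrite hp.
Qed.

Lemma order_geM a b p q : order_ge a p -> order_ge b q -> order_ge (a + b) (p * q).
Proof.
move=> hp hq; rewrite mulr_expand big_seq; apply: order_ge_sum => v vq.
apply: order_geZ; rewrite mull_expand big_seq; apply: order_ge_sum => u up.
apply: order_geZ; rewrite monomM; apply: order_ge_monom.
by rewrite /= size_cat leq_add // (order_ge_msupp hp, order_ge_msupp hq).
Qed.

Lemma delta_gen i j p : delta j (gen i * p) = if i == j then p else 0.
Proof.
have -> : delta j (gen i * p) =
    \sum_(w <- msupp p) mcoeff w p *: (if i == j then mon w else 0).
  rewrite {1}(freeAlgE p) mulr_sumr /delta linear_sum; apply: eq_bigr => w _.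
  by rewrite -scalerAr linearZ /= -/(delta j _) delta_genM.
case: ifP => _; first by rewrite -freeAlgE.
by rewrite big1 // => w _; rewrite scaler0.
Qed.

Lemma cyc_gen i p : cyc (gen i * p) = p * gen i.
Proof.
rewrite {1}(freeAlgE p) mulr_sumr /cyc linear_sum /= mull_expand.
by apply: eq_bigr => w _; rewrite -scalerAr linearZ /= -/(cyc _) cyc_genM.
Qed.

Lemma delta_sum p : order_ge 1 p -> p = \sum_j gen j * delta j p.
Proof.
move=> p1; rewrite {1}(freeAlgE p).
under [RHS]eq_bigr => j _ do
  rewrite {1}(freeAlgE p) /delta linear_sum mulr_sumr.
rewrite exchange_big /= !big_seq; apply: eq_bigr => w wp.
have := order_ge_msupp p1 wp; case: w wp => -[|i v] //= _ _.
rewrite (bigD1 i) //= big1 => [|j /negbTE ji]; last first.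
  by rewrite linearZ /= lin_ext_monom /= eq_sym ji scaler0 mulr0.
by rewrite addr0 linearZ /= lin_ext_monom /= eqxx -scalerAr -monom_cons.
Qed.

(** Both sides equal p: split p by first letters, then apply [cyc], which moves each of these
    letters to the end. *)
Lemma cyclic_syzygy p : order_ge 1 p -> cyclicly_invariant p ->
  \sum_j gen j * delta j p = \sum_j delta j p * gen j.
Proof.
move=> p1 cp; apply: (etrans (esym (delta_sum p1))).
have E : cyc p = cyc (\sum_j gen j * delta j p) by congr (cyc _); exact: delta_sum.
apply: (etrans (esym cp)); apply: (etrans E); rewrite /cyc linear_sum.
by apply: eq_bigr => j _; exact: cyc_gen.
Qed.

Lemma mcoeff_delta j p (w : word n) :
  mcoeff w (delta j p) = mcoeff (FMonom (j :: w)) p.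
Proof.
rewrite {2}(freeAlgE p) /delta /lin_ext !raddf_sum; apply: eq_bigr => u _.
rewrite /= !mcoeffZ; congr (_ * _); case: u => -[|i v] /=.
  by rewrite mcoeff0 mcoeff_monom.
rewrite mcoeff_monom; case: w => w /=.
have E (s t : seq 'I_n) : (FMonom s == FMonom t :> word n) = (s == t) by [].
rewrite E eqseq_cons; case: eqP => _ /=; last by rewrite mcoeff0.
by rewrite mcoeff_monom E.
Qed.

Lemma delta_order_ge m j p : order_ge m.+1 p -> order_ge m (delta j p).
Proof. by move=> hp w wm; rewrite mcoeff_delta hp. Qed.

Lemma hom_comp_order_ge k p :
  (forall m, (m < k)%N -> hom_comp m p = 0) <-> order_ge k p.
Proof.
split=> [hp w wk|hp m mk].
  have := mcoeff_hom_comp (size w) p w.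
  by rewrite /fdeg eqxx => <-; rewrite hp // mcoeff0.
apply/malgP => w; rewrite mcoeff0 mcoeff_hom_comp /fdeg; case: eqP => // wm.
by apply: hp; rewrite wm.
Qed.

End FreeAlgebraExtra.

(** * Functionals on words of bounded length *)

Section Dual.
Variables (K : fieldType) (n D : nat).
Implicit Types p q : freeAlg K n.
Local Notation mon w := (@monom K n (FMonom w)).
Local Notation gen := (@gen K n).

(** Functionals on the free algebra that vanish on words longer than D, stored as row vectors so
    that annihilators become left kernels of matrices. *)
Definition dual := 'rV[K]_#|{: D.-bseq 'I_n}|.
HB.instance Definition _ := Vector.on dual.
Implicit Types f g : dual.

Definition dcoef f (w : seq 'I_n) : K :=
  if insub w is Some b then f ord0 (enum_rank (b : D.-bseq 'I_n)) else 0.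

Definition ev f p : K :=
  \sum_(b : D.-bseq 'I_n) mcoeff (FMonom b) p * f ord0 (enum_rank b).

Definition of_dcoef (h : seq 'I_n -> K) : dual :=
  \row_i h (enum_val i : D.-bseq 'I_n).

Lemma dcoef_out f w : (D < size w)%N -> dcoef f w = 0.
Proof. by move=> wD; rewrite /dcoef insubN // -ltnNge. Qed.

Lemma dcoef_of_dcoef h w : dcoef (of_dcoef h) w = if (size w <= D)%N then h w else 0.
Proof.
rewrite /dcoef; case: insubP => [b wD bw|]; last by move=> /negbTE ->.
by rewrite wD mxE enum_rankK -bw.
Qed.

Lemma dcoef_inj f g : (forall w, dcoef f w = dcoef g w) -> f = g.
Proof.
move=> fg; apply/rowP => i; have := fg (enum_val i : D.-bseq 'I_n).
by rewrite /dcoef valK enum_valK (ord1 0).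
Qed.

Lemma dcoefD f g w : dcoef (f + g) w = dcoef f w + dcoef g w.
Proof. by rewrite /dcoef; case: insub => [b|]; rewrite ?mxE ?addr0. Qed.

Lemma dcoefZ c f w : dcoef (c *: f) w = c * dcoef f w.
Proof. by rewrite /dcoef; case: insub => [b|]; rewrite ?mxE ?mulr0. Qed.

Lemma dcoef0 w : dcoef 0 w = 0.
Proof. by rewrite /dcoef; case: insub => [b|]; rewrite ?mxE. Qed.

Lemma evD f p q : ev f (p + q) = ev f p + ev f q.
Proof. by rewrite -big_split /=; apply: eq_bigr => b _; rewrite mcoeffD mulrDl. Qed.

Lemma evZ f c p : ev f (c *: p) = c * ev f p.
Proof.
by rewrite /ev mulr_sumr; apply: eq_bigr => b _; rewrite mcoeffZ mulrA.
Qed.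

Lemma ev0 f : ev f 0 = 0.
Proof. by rewrite -(scale0r 0) evZ mul0r. Qed.

Lemma evB f p q : ev f (p - q) = ev f p - ev f q.
Proof. by rewrite evD -scaleN1r evZ mulN1r. Qed.

Lemma ev_sum f (I : Type) (r : seq I) (P : pred I) (E : I -> freeAlg K n) :
  ev f (\sum_(i <- r | P i) E i) = \sum_(i <- r | P i) ev f (E i).
Proof. by apply: (big_morph (ev f)) => [p q|]; rewrite ?evD ?ev0. Qed.

Lemma ev_monom f w : ev f (mon w) = dcoef f w.
Proof.
have E (b : D.-bseq 'I_n) : mcoeff (FMonom b) (mon w) = ((w : seq _) == b)%:R.
  by rewrite mcoeff_monom.
rewrite /ev /dcoef; case: insubP => [b wD bw|wD]; last first.
  apply: big1 => b _; rewrite E; case: eqP => [wb|]; rewrite ?mul0r //.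
  by move: wD; rewrite wb size_bseq.
rewrite (bigD1 b) //= big1 ?addr0 => [|c cb]; rewrite E -bw.
  by rewrite eqxx mul1r.
by rewrite eq_sym (inj_eq val_inj) (negbTE cb) mul0r.
Qed.

Lemma ev_expand f p : ev f p = \sum_(w <- msupp p) mcoeff w p * dcoef f w.
Proof.
by rewrite {1}(freeAlgE p) ev_sum; apply: eq_bigr => w _; rewrite evZ ev_monom.
Qed.

Lemma ev_mulr0 f p q : (forall w, ev f (p * mon w) = 0) -> ev f (p * q) = 0.
Proof.
by move=> h; rewrite mulr_expand ev_sum big1 // => w _; rewrite evZ h mulr0.
Qed.

Lemma ev_mull0 f p q : (forall w, ev f (mon w * q) = 0) -> ev f (p * q) = 0.
Proof.
by move=> h; rewrite mull_expand ev_sum big1 // => w _; rewrite evZ h mulr0.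
Qed.

Lemma ev_lin c f g p : ev (c *: f + g) p = c * ev f p + ev g p.
Proof.
rewrite !ev_expand mulr_sumr -big_split /=; apply: eq_bigr => w _.
by rewrite dcoefD dcoefZ mulrDr mulrCA.
Qed.

Lemma ev0l p : ev 0 p = 0.
Proof. by rewrite ev_expand big1 // => w _; rewrite dcoef0 mulr0. Qed.

Lemma ev_suml (I : Type) (r : seq I) (P : pred I) (E : I -> dual) p :
  ev (\sum_(i <- r | P i) E i) p = \sum_(i <- r | P i) ev (E i) p.
Proof.
apply: (big_morph (fun f => ev f p)) => [f g|]; last exact: ev0l.
by rewrite -[f in LHS]scale1r ev_lin mul1r.
Qed.

Lemma ev_order i f p : (forall w, (i <= size w)%N -> dcoef f w = 0) ->
  order_ge i p -> ev f p = 0.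
Proof.
move=> fi pi; rewrite ev_expand big_seq big1 // => w wp.
by rewrite fi ?mulr0 // (order_ge_msupp pi).
Qed.

Lemma ev_order_D f p : order_ge D.+1 p -> ev f p = 0.
Proof. by apply: ev_order => w; apply: dcoef_out. Qed.

(** The transpose of left multiplication by p. Truncation at length D loses nothing, as p w has
    order above D for longer w. *)
Definition lmul p f : dual := of_dcoef (fun w => ev f (p * mon w)).

Lemma dcoef_lmul p f w : dcoef (lmul p f) w = ev f (p * mon w).
Proof.
rewrite dcoef_of_dcoef; case: leqP => // Dw; rewrite ev_order_D //.
rewrite -[D.+1]add0n; apply: order_geM => //.
exact: order_ge_monom.
Qed.

Lemma ev_lmul p f q : ev (lmul p f) q = ev f (p * q).
Proof.
rewrite ev_expand mulr_expand ev_sum; apply: eq_bigr => w _.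
by rewrite evZ dcoef_lmul.
Qed.

Lemma lmul_is_linear p : linear (lmul p).
Proof.
move=> c f g; apply: dcoef_inj => w.
by rewrite dcoefD dcoefZ !dcoef_lmul ev_lin.
Qed.
HB.instance Definition _ p :=
  GRing.isLinear.Build K dual dual _ (lmul p) (lmul_is_linear p).

End Dual.

(** * The Golod-Shafarevich recursion *)

Section Annihilator.
Variables (K : fieldType) (n D : nat) (F : freeAlg K n).
Implicit Types p q : freeAlg K n.
Local Notation mon w := (@monom K n (FMonom w)).
Local Notation gen := (@gen K n).
Local Notation dual := (dual K n D).
Local Notation delta := (@delta K n).
Implicit Types f g : dual.

Lemma mulrAA a b c d : a * (b * c) * d = a * b * (c * d) :> freeAlg K n.
Proof.
apply: etrans (congr1 (fun x => x * d) (mulrA a b c)) _.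
exact: esym (mulrA _ _ _).
Qed.

Lemma mulrBA a b c d : a * (b - c) * d = a * b * d - a * c * d :> freeAlg K n.
Proof.
by apply: etrans (congr1 (fun x => x * d) (mulrBr a b c)) _; exact: mulrBl.
Qed.

Lemma pot_ideal_delta j : pot_ideal F (delta j F).
Proof. by move=> J [_]; apply; exists j. Qed.

(** The elements q such that f kills u q v for all words u, v form a two-sided ideal, so it suffices
    that this ideal contains the relators. *)
Lemma ev_pot_ideal f :
  (forall u v j, ev f (mon u * delta j F * mon v) = 0) ->
  forall q, pot_ideal F q -> ev f q = 0.
Proof.
move=> fr q.
suff : pot_ideal F q -> forall u v, ev f (mon u * q * mon v) = 0.
  move=> + /[dup] Fq => /[apply] /(_ [::] [::]).
  by rewrite (monom1 K n) mul1r mulr1.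
apply: (@smallest_sub _ _ _ (fun q => forall u v, ev f (mon u * q * mon v) = 0)).
- split=> [u v|x y hx hy u v|a x hx u v|a x hx u v].
  + by rewrite mulr0 mul0r ev0.
  + apply: etrans (congr1 (ev f) (mulrBA _ _ _ _)) _; apply: etrans (evB _ _ _) _.
    by apply: etrans (congr2 (fun a b => a - b) (hx u v) (hy u v)) _; rewrite subrr.
  + apply: etrans (congr1 (ev f) (mulrAA _ _ _ _)) _; apply: ev_mull0 => w.
    by apply: etrans (congr1 (ev f) (mulrA _ _ _)) _; exact: hx.
  + apply: etrans (congr1 (ev f) (mulrAA _ _ _ _)) _; apply: ev_mulr0 => w; exact: hx.
- by move=> _ [j _ <-] u v; apply: fr.
Qed.

Definition annih_pred i f : Prop :=
  (forall w, (i <= size w)%N -> dcoef f w = 0) /\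
  (forall q, pot_ideal F q -> ev f q = 0).

Lemma annih_exists i : exists U : {vspace dual}, forall f, f \in U <-> annih_pred i f.
Proof.
apply: vspace_of_pred.
  split=> [w _|q _]; [exact: dcoef0 | exact: ev0l].
move=> c f g [f1 f2] [g1 g2]; split=> [w wi|q Fq].
  by rewrite dcoefD dcoefZ f1 // g1 // mulr0 addr0.
by rewrite ev_lin f2 // g2 // mulr0 addr0.
Qed.

(* The dual of the quotient of the free algebra by the potential ideal and all
   words of length at least i, for i <= D.+1. *)
Definition annih i : {vspace dual} := projT1 (cid (annih_exists i)).

Lemma annihP i f : f \in annih i <-> annih_pred i f.
Proof. exact: (projT2 (cid (annih_exists i))). Qed.

Lemma annihS i j : (i <= j)%N -> (annih i <= annih j)%VS.
Proof.
move=> ij; apply/subvP => f /annihP[f1 f2]; apply/annihP; split=> // w jw.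
by apply: f1; apply: leq_trans jw.
Qed.

Lemma annih0 : annih 0 = 0%VS.
Proof.
apply/eqP; rewrite -subv0; apply/subvP => f /annihP[f0 _].
by rewrite memv0; apply/eqP/dcoef_inj => w; rewrite f0 // dcoef0.
Qed.

Lemma annih_lmul j i f : f \in annih i.+1 -> lmul (gen j) f \in annih i.
Proof.
move=> /annihP[f1 f2]; apply/annihP; split=> [w iw|q Fq].
  by rewrite dcoef_lmul -monom_cons ev_monom f1.
rewrite ev_lmul f2 //; have [_ _ h _] := pot_ideal_two_sided F; exact: h.
Qed.

Section Glue.
Variable d : nat.
Let X := (K^o * {ffun 'I_n -> subvs_of (annih d)})%type.

(** A functional amounts to its value at the empty word and its restrictions along each first
    letter; this is the inverse of that decomposition. *)
Definition glue (x : X) : dual :=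
  of_dcoef D (fun w => if w is j :: v then dcoef (vsval (x.2 j)) v else x.1).

Lemma glue_is_linear : linear glue.
Proof.
move=> c x y; apply: dcoef_inj => w; rewrite dcoefD dcoefZ !dcoef_of_dcoef.
case: ifP => _; last by rewrite mulr0 addr0.
by case: w => [|j v] //=; rewrite !ffunE linearP dcoefD dcoefZ.
Qed.
HB.instance Definition _ := GRing.isLinear.Build K X dual _ glue glue_is_linear.

Hypothesis dD : (d <= D)%N.

Lemma lmul_glue j x : lmul (gen j) (glue x) = vsval (x.2 j).
Proof.
apply: dcoef_inj => v; rewrite dcoef_lmul -monom_cons ev_monom dcoef_of_dcoef /=.
case: ltnP => // Dv; have /annihP[-> //] := subvsP (x.2 j).
exact: leq_trans Dv.
Qed.

Lemma ev_glue_gen j x p : ev (glue x) (gen j * p) = ev (vsval (x.2 j)) p.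
Proof. by rewrite -ev_lmul lmul_glue. Qed.

Lemma glue_inj x : glue x = 0 -> x = 0.
Proof.
case: x => c g g0; congr (_, _).
  have := dcoef_of_dcoef D
    (fun w => if w is j :: v then dcoef (vsval (g j)) v else c) [::].
  by rewrite -/(glue (c, g)) g0 dcoef0.
apply/ffunP => j; apply: subvs_inj; rewrite ffunE linear0.
by have := lmul_glue j (c, g); rewrite g0 linear0.
Qed.

Lemma dcoef_glue_out x w : (d < size w)%N -> dcoef (glue x) w = 0.
Proof.
case: w => // j v dv; rewrite -ev_monom monom_cons ev_glue_gen ev_monom.
by have /annihP[-> //] := subvsP (x.2 j).
Qed.

End Glue.

(** The relator map [psi] on glued functionals has its kernel inside [annih d.+1] and its image
    inside the kernel [Y] of the syzygy map [chi]. Surjectivity along z bounds the dimension of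
    [Y]. *)
Lemma annih_golod_shafarevich l d z : (d <= D)%N ->
  order_ge l.+3 F -> cyclicly_invariant F ->
  (forall g, g \in annih (d - l.+2) ->
     exists2 f, f \in annih (d - l.+1) & lmul (gen z) f = g) ->
  (1 + n * \dim (annih d) + \dim (annih (d - l.+2)) <=
   \dim (annih d.+1) + n * \dim (annih (d - l.+1)))%N.
Proof.
move=> dD Fl Fc zsurj.
pose X := (K^o * {ffun 'I_n -> subvs_of (annih d)})%type.
have dimX : \dim {:X} = (1 + n * \dim (annih d))%N.
  have dimW : dim {ffun 'I_n -> subvs_of (annih d)} = (n * \dim (annih d))%N.
    by rewrite {1}/dim /= card_ord.
  by rewrite -dimW dimvf.
have rl j : order_ge l.+2 (delta j F) by apply: delta_order_ge.
have Kd x j v q : pot_ideal F q -> ev (glue (d := d) x) (gen j * q * mon v) = 0.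
  move=> Fq; rewrite -[gen j * _ * _]mulrA ev_glue_gen //.
  have /annihP[_ -> //] := subvsP (x.2 j).
  by have [_ _ _ h] := pot_ideal_two_sided F; apply: h.
pose psi (x : X) : {ffun 'I_n -> dual} := [ffun i => lmul (delta i F) (glue x)].
have psi_lin : linear psi.
  by move=> c x y; apply/ffunP => i; rewrite !ffunE !linearP.
pose psiL : {linear X -> {ffun 'I_n -> dual}} :=
  HB.pack psi (GRing.isLinear.Build _ _ _ _ psi psi_lin).
pose chi (h : {ffun 'I_n -> dual}) : dual := \sum_i lmul (gen i) (h i).
have chi_lin : linear chi.
  move=> c g h; rewrite /chi scaler_sumr -big_split; apply: eq_bigr => i _.
  by rewrite !ffunE linearP.
pose chiL : {linear {ffun 'I_n -> dual} -> dual} :=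
  HB.pack chi (GRing.isLinear.Build _ _ _ _ chi chi_lin).
have [P PP] : exists P : {vspace {ffun 'I_n -> dual}},
    forall h, h \in P <-> forall i, h i \in annih (d - l.+1).
  apply: vspace_of_pred => [i|c g h hg hh i]; first by rewrite ffunE mem0v.
  by rewrite !ffunE memvD // memvZ.
have [Y YP] : exists Y : {vspace {ffun 'I_n -> dual}},
    forall h, h \in Y <-> h \in P /\ chi h = 0.
  apply: vspace_of_pred => [|c g h [gP g0] [hP h0]].
    by split; [exact: mem0v | exact: (linear0 chiL)].
  by split; [rewrite memvD ?memvZ | rewrite chi_lin g0 h0 scaler0 addr0].
have le1 : (\dim {:X} <= \dim Y + \dim (annih d.+1))%N.
  apply: (dimv_ker_le (f := psiL) (g := @glue d)).
  (* Composing with [chi] evaluates f on (sum r_i x_i) w = (sum x_i r_i) w, which gives 0 because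
     each f(x_i .) kills the ideal. *)
  - move=> x _; apply/YP; split; last first.
      apply: dcoef_inj => w; rewrite dcoef0 /chi /= -ev_monom.
      have -> : ev (\sum_i lmul (gen i) (psi x i)) (mon w) =
          ev (glue x) ((\sum_i delta i F * gen i) * mon w).
        rewrite mulr_suml ev_sum ev_suml; apply: eq_bigr => i _.
        rewrite ev_lmul ffunE ev_lmul.
        exact: (congr1 (ev (glue x)) (mulrA _ _ _)).
      rewrite -cyclic_syzygy //; last by apply: order_ge_leq Fl.
      by rewrite mulr_suml ev_sum big1 // => i _; rewrite Kd //; apply: pot_ideal_delta.
    (* If w has length at least d - l - 1, then r_i w has order at least d + 1, where glued
       functionals vanish. If q is in the ideal, splitting r_i by first letters writes r_i q as a
       sum of x_j q' with q' in the ideal. *)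
    apply/PP => i; rewrite ffunE; apply/annihP; split=> [w dw|q Fq].
      rewrite dcoef_lmul; apply: (ev_order (i := d.+1)) => [v|].
        exact: dcoef_glue_out.
      apply: (order_ge_leq (m := l.+2 + size w)); first lia.
      by apply: order_geM => //; apply: order_ge_monom.
    rewrite ev_lmul (delta_sum (p := delta i F)); last by apply: order_ge_leq (rl i).
    rewrite mulr_suml ev_sum big1 // => j _.
    rewrite -[gen j * _ * _]mulrA ev_glue_gen //.
    have /annihP[_ -> //] := subvsP (x.2 j).
    by have [_ _ h _] := pot_ideal_two_sided F; apply: h.
  - move=> x _ /= psi0; apply/annihP; split=> [w|]; first exact: dcoef_glue_out.
    (* For u empty the vanishing is [psi0]; otherwise the first letter of u leads into a component
       that already kills the ideal. *)
    apply: ev_pot_ideal => -[|i u] v j.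
      rewrite (monom1 K n) mul1r -ev_lmul ev_monom.
      have := congr1 (fun h : {ffun 'I_n -> dual} => h j) psi0.
      by rewrite !ffunE => ->; rewrite dcoef0.
    rewrite monom_cons.
    apply: (etrans (congr1 (fun y => ev (glue x) (y * mon v)) (esym (mulrA _ _ _)))).
    apply: Kd.
    have [_ _ h _] := pot_ideal_two_sided F; apply: h; exact: pot_ideal_delta.
  - by move=> x _ /=; apply: glue_inj.
(* [chi] maps [P] onto [annih (d - l.+2)]: put a preimage under f |-> f(z .) in coordinate z and 0
   elsewhere. *)
have le2 : (\dim Y + \dim (annih (d - l.+2)) <= \dim P)%N.
  apply: (dimv_surj_ker (f := chiL)) => [h /YP //|g /zsurj[f fS fg]].
  exists [ffun i => if i == z then f else 0].
    by apply/PP => i; rewrite ffunE; case: ifP; rewrite ?mem0v.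
  rewrite /= /chi (bigD1 z) //= ffunE eqxx fg big1 ?addr0 // => i /negbTE iz.
  by rewrite ffunE iz linear0.
move: le1 le2; rewrite dimX (dimv_pow PP).
move: (\dim Y) (\dim (annih d)) => y a0; move: (\dim _) (\dim _) (\dim _) => a1 a2 a3.
lia.
Qed.

End Annihilator.

(** * Perturbation towards a potential with normal words *)

Section GrowthDual.
Variables (K : fieldType) (n D : nat) (F : freeAlg K n).
Local Notation mon w := (@monom K n (FMonom w)).

(** Evaluation at lifts of a basis of the filtration is injective: every word of length at most D is
    congruent to a combination of these lifts. *)
Lemma dim_annih_le_growth : (\dim (annih D F D.+1) <= growth F D)%N.
Proof.
have [e [free_e span_e]] := growthP F D.
have /choice[p pE] (i : 'I_(growth F D)) :
    exists p, deg_le D p /\ pot_pi F p = e i.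
  have : @filtration K n F D (e i).
    rewrite span_e /=; exists (fun j => (j == i)%:R).
    rewrite (bigD1 i) //= eqxx scale1r big1 ?addr0 // => j /negbTE ->.
    by rewrite scale0r.
  by move=> [q qD qe]; exists q.
pose r (f : dual K n D) : 'rV[K]_(growth F D) := \row_i ev f (p i).
have r_lin : linear r.
  by move=> c f g; apply/rowP => i; rewrite !mxE ev_lin.
pose rL : {linear dual K n D -> 'rV[K]_(growth F D)} :=
  HB.pack r (GRing.isLinear.Build _ _ _ _ r r_lin).
have le : (\dim (annih D F D.+1) <= \dim {:'rV[K]_(growth F D)})%N.
  apply: (dimv_inj (f := rL)) => f /annihP[f1 f2]; last by rewrite memvf.
  move=> rf0; apply: dcoef_inj => w; rewrite dcoef0.
  case: (leqP (size w) D) => [wD|]; last exact: f1.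
  have : @filtration K n F D (pot_pi F (mon w)).
    exists (mon w) => // u; rewrite -mcoeff_neq0 mcoeff_monom.
    have [<- //|_] := eqVneq (FMonom w : word n) u; by rewrite eqxx.
  rewrite span_e => -[c cE].
  have /f2 : pot_ideal F (mon w - \sum_i c i *: p i).
    apply/pot_piP; rewrite cE raddf_sum; apply: eq_bigr => i _.
    by rewrite -(pE i).2; apply: esym; exact: linearZ.
  rewrite evB ev_monom ev_sum big1 ?subr0 // => i _.
  have := congr1 (fun M : 'rV_ _ => M 0 i) rf0; rewrite !mxE => h.
  by rewrite evZ h mulr0.
by move: le; rewrite dimv_rV.
Qed.

End GrowthDual.

Section Separation.
Variables (K : fieldType) (n l D : nat).
Hypothesis lpn_gt0 : (0 < l + n)%N.
Local Notation mon w := (@monom K n.+2 (FMonom w)).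
Local Notation gen := (@gen K n.+2).
Local Notation dual := (dual K n.+2 D).
Local Notation NW := (normal_words n l).
Implicit Types F G H : freeAlg K n.+2.

(** Dual form of the statement that normal words of length at most D span the quotient by the ideal
    and all longer words. *)
Definition separated F : Prop :=
  forall f, f \in annih D F D.+1 ->
    (forall w, normal l w -> (size w <= D)%N -> dcoef f w = 0) -> f = 0.

Definition restr i (f : dual) : 'rV[K]_(size (NW i)) :=
  \row_j dcoef f (nth [::] (NW i) j).

Lemma restr_is_linear i : linear (restr i).
Proof. by move=> c f g; apply/rowP => j; rewrite !mxE dcoefD dcoefZ. Qed.
HB.instance Definition _ i := GRing.isLinear.Build K dual _ _ (restr i)
  (restr_is_linear i).

Lemma restr0P i f w : restr i f = 0 -> normal l w -> (size w < i)%N -> dcoef f w = 0.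
Proof.
move=> rf0 Nw wi; have wN : w \in NW i by rewrite mem_normal_words wi.
have wsz : (index w (NW i) < size (NW i))%N by rewrite index_mem.
have := congr1 (fun M : 'rV_ _ => M 0 (Ordinal wsz)) rf0; rewrite !mxE.
by rewrite nth_index.
Qed.

Section Potential.
Variable F : freeAlg K n.+2.
Hypotheses (Fl : order_ge l.+3 F) (Fc : cyclicly_invariant F).
Hypothesis Fs : separated F.
Local Notation annih := (annih D F).

Lemma restr_inj i f : (i <= D.+1)%N -> f \in annih i -> restr i f = 0 -> f = 0.
Proof.
move=> iD fi rf0; apply: Fs => [|w Nw wD]; first exact: (subvP (annihS _ _ iD)).
have [wi|iw] := ltnP (size w) i; first exact: restr0P rf0 Nw wi.
by have /annihP[-> //] := fi.
Qed.

Lemma dim_annih_le i : (i <= D.+1)%N -> (\dim (annih i) <= size (NW i))%N.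
Proof.
move=> iD.
have le : (\dim (annih i) <= \dim {:'rV[K]_(size (NW i))})%N.
  by apply: (dimv_inj (f := restr i)) => f fi; [exact: restr_inj|rewrite memvf].
by move: le; rewrite dimv_rV.
Qed.

(** With equal dimensions the injective restriction is bijective, so values on normal words can be
    prescribed. *)
Lemma restr_surj i h : (i <= D.+1)%N -> \dim (annih i) = size (NW i) ->
  exists2 f, f \in annih i & restr i f = h.
Proof.
move=> iD dimi.
have /vspaceP/(_ h) : (linfun (restr i) @: annih i)%VS = fullv.
  apply/eqP; rewrite eqEdim subvf /= limg_dim_eq; last first.
    apply/eqP; rewrite -subv0; apply/subvP => f.
    rewrite memv_cap memv_ker lfunE /= => /andP[fi /eqP rf].
    by rewrite (restr_inj iD fi rf) mem0v.
  by rewrite dimv_rV dimi.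
rewrite memvf => /memv_imgP[f fi ->]; exists f => //.
by rewrite lfunE.
Qed.

(** Prescribe f(z w) = g(w) for normal w, which is possible as z w is again normal. Then f(z .) and
    g agree on normal words, hence coincide. *)
Lemma lmul_lz_surj i g : (i <= D)%N ->
  \dim (annih i.+1) = size (NW i.+1) -> g \in annih i ->
  exists2 f, f \in annih i.+1 & lmul (gen (lz n)) f = g.
Proof.
move=> iD dimi gi.
(* Only the entries at words beginning with z are read later; the others are arbitrary. *)
pose h : 'rV[K]_(size (NW i.+1)) :=
  \row_j dcoef g (behead (nth [::] (NW i.+1) j)).
have [f fi fh] := restr_surj h (iD : (i.+1 <= D.+1)%N) dimi.
exists f => //; apply/eqP; rewrite -subr_eq0; apply/eqP.
have lfi : lmul (gen (lz n)) f \in annih i by apply: annih_lmul.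
apply: (@restr_inj i); rewrite ?memvB // 1?ltnW //.
apply/rowP => j; rewrite linearB !mxE.
have := mem_nth [::] (ltn_ord j); set w := nth _ _ _ => wN.
have /andP[wi Nw] : (size w < i)%N && normal l w by rewrite -mem_normal_words.
have zwN : lz n :: w \in NW i.+1.
  rewrite mem_normal_words /= ltnS wi.
  by rewrite -[_ && _]/(normal l (lz n :: w)) normal_lz.
rewrite dcoef_lmul -monom_cons ev_monom.
have zsz : (index (lz n :: w) (NW i.+1) < size (NW i.+1))%N by rewrite index_mem.
have := congr1 (fun M : 'rV_ _ => M 0 (Ordinal zsz)) fh; rewrite !mxE nth_index //.
by move=> ->; rewrite subrr.
Qed.

Lemma dim_annih_normal_rec d : (d <= D)%N ->
  (forall i, (i <= d)%N -> \dim (annih i) = size (NW i)) ->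
  (1 + n.+2 * size (NW d) + size (NW (d - l.+2)) <=
    \dim (annih d.+1) + n.+2 * size (NW (d - l.+1)))%N.
Proof.
move=> dD IH; rewrite -!IH ?leq_subr //.
apply: (annih_golod_shafarevich (z := lz n)) => // g; case E : (d - l.+1)%N => [|e].
  have -> : (d - l.+2 = 0)%N by lia.
  by rewrite annih0 memv0 => /eqP ->; exists 0; rewrite ?mem0v ?linear0.
have -> : (d - l.+2 = e)%N by lia.
by apply: lmul_lz_surj; [lia|apply: IH; lia].
Qed.

(** Separation bounds the dimension above by the number of normal words. Below, equality in lower
    degrees makes z surjective, and the resulting recursion meets the combinatorial bound
    [size_normal_words_rec]. *)
Lemma dim_annihE i : (i <= D.+1)%N -> \dim (annih i) = size (NW i).
Proof.
elim/ltn_ind: i => -[|d] IH dD; first by rewrite annih0 dimv0.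
apply/eqP; rewrite eqn_leq dim_annih_le // andTb.
have := dim_annih_normal_rec (dD : (d <= D)%N)
  (fun i id => IH i id (leq_trans id (ltnW dD))).
have := size_normal_words_rec lpn_gt0 d.
move: (size (NW d.+1)) (size (NW d)) (size (NW (d - l.+1))) (size (NW (d - l.+2))).
by move: (\dim _) => a b c e f; lia.
Qed.

End Potential.

(** * Annihilators as kernels of matrices *)

Local Notation B := (D.-bseq 'I_n.+2).

Definition relator F (x : B * 'I_n.+2 * B) : freeAlg K n.+2 :=
  mon x.1.1 * delta x.1.2 F * mon x.2.

(** Its left kernel is [annih D F D.+1]. It is linear in F, so a line of potentials yields a pencil
    of matrices. *)
Definition relmx F : 'M[K]_(#|{: B}|, #|{: B * 'I_n.+2 * B}|) :=
  \matrix_(i, c) mcoeff (FMonom (enum_val i : B)) (relator F (enum_val c)).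

Definition normalmx : 'M[K]_(#|{: B}|, size (NW D.+1)) :=
  \matrix_(i, j) (nth [::] (NW D.+1) j == (enum_val i : B))%:R.

Lemma mul_relmx F (f : dual) c :
  (f *m relmx F) 0 c = ev f (relator F (enum_val c)).
Proof.
rewrite mxE /ev (reindex (@enum_val {: B} predT)) /=; last first.
  exact/onW_bij/enum_val_bij.
by apply: eq_bigr => i _; rewrite enum_valK mxE mulrC.
Qed.

Lemma mul_normalmx (f : dual) : f *m normalmx = restr D.+1 f.
Proof.
apply/rowP => j; rewrite !mxE.
have := mem_nth [::] (ltn_ord j); rewrite mem_normal_words ltnS => /andP[wD _].
rewrite /dcoef insubT; set b := Sub _ _ : B.
rewrite (bigD1 (enum_rank b)) //= big1 => [|i ib]; rewrite !mxE.
  by rewrite enum_rankK eqxx mulr1 addr0.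
case: eqP => [E|]; last by rewrite mulr0.
case/eqP: ib; apply: (can_inj enum_valK); rewrite enum_rankK.
by apply: val_inj; rewrite /= E.
Qed.

(** Finitely many columns suffice: if u or v is longer than D, then u r_j v has order above D and is
    killed by f. *)
Lemma annih_relmx F f : f \in annih D F D.+1 <-> f *m relmx F = 0.
Proof.
split=> [/annihP[_ f2]|fM].
  apply/rowP => c; rewrite mul_relmx mxE; apply: f2.
  have [_ _ hl hr] := pot_ideal_two_sided F.
  by apply: hr; apply: hl; apply: pot_ideal_delta.
apply/annihP; split=> [w|]; first exact: dcoef_out.
apply: ev_pot_ideal => u v j.
have [uD|uD] := leqP (size u) D; last first.
  apply: ev_order_D; apply: (order_ge_leq (m := size u + 0 + size v)); first lia.
  by apply: order_geM; [apply: order_geM|];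
    [apply: order_ge_monom| |apply: order_ge_monom].
have [vD|vD] := leqP (size v) D; last first.
  apply: ev_order_D; apply: (order_ge_leq (m := size u + 0 + size v)); first lia.
  by apply: order_geM; [apply: order_geM|];
    [apply: order_ge_monom| |apply: order_ge_monom].
have := mul_relmx F f (enum_rank (Bseq uD, j, Bseq vD)).
by rewrite fM mxE enum_rankK.
Qed.

Lemma mulrDZA (a b c d : freeAlg K n.+2) (t : K) :
  a * (b + t *: c) * d = a * b * d + t *: (a * c * d).
Proof.
apply: etrans (congr1 (fun x => x * d) (mulrDr a b (t *: c))) _.
apply: etrans (mulrDl _ _ _) _; congr (_ + _).
apply: etrans (congr1 (fun x => x * d) (esym (scalerAr t a c))) _.
exact: esym (scalerAl _ _ _).
Qed.

Lemma relmx_pencil F E t : relmx (F + t *: E) = relmx F + t *: relmx E.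
Proof.
apply/matrixP => i c; rewrite !mxE -mcoeffZ -mcoeffD /relator.
have -> j : delta j (F + t *: E) = delta j F + t *: delta j E.
  by rewrite /delta linearD linearZ.
congr (mcoeff _ _); exact: mulrDZA.
Qed.

Lemma separated_rank F :
  separated F <-> \rank (row_mx (relmx F) normalmx) = #|{: B}|.
Proof.
split=> [Fs|/eqP rk f /annih_relmx fM fN].
  apply/eqP; rewrite -/(row_free _) -kermx_eq0; apply/rowV0P => f /sub_kermxP.
  rewrite mul_mx_row -row_mx0 => /eq_row_mx[fM].
  rewrite mul_normalmx => fN; apply: Fs => [|w Nw wD]; first exact/annih_relmx.
  exact: restr0P fN Nw _.
have /row_freeP[C HC] : row_free (row_mx (relmx F) normalmx) by [].
rewrite -[f]mulmx1 -HC mulmxA mul_mx_row fM mul_normalmx.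
have -> : restr D.+1 f = 0.
  apply/rowP => j; rewrite !mxE.
  have := mem_nth [::] (ltn_ord j); rewrite mem_normal_words ltnS => /andP[wD Nw].
  exact: fN.
by rewrite row_mx0 mul0mx.
Qed.

End Separation.

Lemma cyc_pencil (K : fieldType) n (F E : freeAlg K n) (t : K) :
  cyclicly_invariant F -> cyclicly_invariant E -> cyclicly_invariant (F + t *: E).
Proof.
move=> Fc Ec; rewrite /cyclicly_invariant /cyc linearD linearZ /=.
by rewrite -/(cyc F) -/(cyc E) Fc Ec.
Qed.

(** Generic t gives at least the rank of [relmx] found at t = 0, so the annihilator is no larger
    than that of F, and at least the separation rank found at t = 1, where the potential is G. *)
Lemma perturbation (K : closedFieldType) n l D (F G : freeAlg K n.+2) :
  (0 < l + n)%N -> separated l D G -> exists t,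
    separated l D (F + t *: (G - F)) /\
    (\dim (annih D (F + t *: (G - F))%R D.+1) <= \dim (annih D F D.+1))%N.
Proof.
move=> ln Gs; set E := G - F.
have [P1 P1n h1] := rank_pencil_generic (relmx D F) (relmx D E) 0.
have [P2 P2n h2] := rank_pencil_generic
  (row_mx (relmx D F) (normalmx K n l D)) (row_mx (relmx D E) 0) 1.
(* Algebraic closedness supplies a t outside the roots of both polynomials. *)
have /closed_nonrootP[t] : P1 * P2 != 0 by rewrite mulf_neq0.
rewrite rootM negb_or => /andP[/h1 {}h1 /h2 {}h2]; exists t; split.
  apply/(separated_rank D ln); apply/eqP; rewrite eqn_leq rank_leq_row /=.
  have rowE s : row_mx (relmx D F) (normalmx K n l D) + s *: row_mx (relmx D E) 0 =
      row_mx (relmx D (F + s *: E)) (normalmx K n l D).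
    by rewrite scale_row_mx add_row_mx scaler0 addr0 relmx_pencil.
  have h3 := (separated_rank D ln G).1 Gs.
  have h4 : F + 1 *: E = G by rewrite scale1r /E [F + _]addrC subrK.
  rewrite rowE h4 in h2; rewrite rowE in h2.
  by apply: leq_trans h2; rewrite h3.
rewrite scale0r addr0 -(relmx_pencil D F E t) in h1.
have e1 := dimv_kermx (annih_relmx (D := D) ln F).
have e2 := dimv_kermx (annih_relmx (D := D) ln (F + t *: E)).
exact: leq_trans (eq_leq e2) (leq_trans (leq_sub2l _ h1) (eq_leq (esym e1))).
Qed.

Lemma growth_ge_normal_words (K : closedFieldType) n l D (F G : freeAlg K n.+2) :
  (0 < l + n)%N ->
  order_ge l.+3 F -> cyclicly_invariant F ->
  order_ge l.+3 G -> cyclicly_invariant G -> separated l D G ->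
  (size (normal_words n l D.+1) <= growth F D)%N.
Proof.
move=> ln Fl Fc Gl Gc Gs; have [t [Hs le]] := perturbation F ln Gs.
have GF : cyclicly_invariant (G - F).
  by rewrite -scaleN1r; apply: cyc_pencil.
have oGF : order_ge l.+3 (G - F).
  by rewrite -scaleN1r; apply: order_geD => //; apply: order_geZ.
have := dim_annihE ln _ _ Hs (leqnn D.+1) => <-.
- by apply: leq_trans le _; exact: dim_annih_le_growth.
- by apply: order_geD => //; apply: order_geZ.
- exact: cyc_pencil.
Qed.

(** * The model potential *)

Section DegLex.
Variable n : nat.
Implicit Types u v w : seq 'I_n.+2.

(* The digits decrease with the letters, so that comparing the codes of words of
   the same length is the lexicographic order with x > y > ... > z. *)
Definition code : seq 'I_n.+2 -> nat :=
  foldl (fun (a : nat) (j : 'I_n.+2) => (a * n.+2 + (n.+1 - j))%N) 0%N.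

Lemma code_rcons w j : code (rcons w j) = (code w * n.+2 + (n.+1 - j))%N.
Proof. by rewrite /code foldl_rcons. Qed.

Lemma code_lt w : (code w < n.+2 ^ size w)%N.
Proof.
elim/last_ind: w => [|w j IH] //; rewrite code_rcons size_rcons expnSr; nia.
Qed.

Lemma code_cat u v : code (u ++ v) = (code u * n.+2 ^ size v + code v)%N.
Proof.
elim/last_ind: v => [|v j IH]; first by rewrite cats0 expn0 muln1 addn0.
by rewrite -rcons_cat !code_rcons IH size_rcons expnSr; lia.
Qed.

Lemma code_cat_lt u u' v v' : size v = size v' ->
  (code u < code u')%N -> (code (u ++ v) < code (u' ++ v'))%N.
Proof. by move=> vv uu; rewrite !code_cat vv; have := code_lt v; rewrite vv; nia. Qed.

Lemma code_lex u (a b : 'I_n.+2) v v' : size v = size v' ->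
  (b < a)%N -> (code (u ++ a :: v) < code (u ++ b :: v'))%N.
Proof.
move=> vv ba; rewrite -!cat_rcons; apply: code_cat_lt => //.
by rewrite !code_rcons; have := ltn_ord a; lia.
Qed.

(** Compatibility of the order with multiplication, so that rewriting a factor lowers the code of
    the whole word. *)
Lemma code_sandwich u v w w' : size w = size w' ->
  (code w < code w')%N -> (code (u ++ w ++ v) < code (u ++ w' ++ v))%N.
Proof.
move=> ww lt; rewrite !catA; apply: code_cat_lt => //.
by rewrite !code_cat ww ltn_add2l.
Qed.

End DegLex.

Lemma not_normal_factor n l (w : seq 'I_n.+2) : ~~ normal l w ->
  exists u j v, w = u ++ lead l j ++ v.
Proof.
elim: w => [|a w IH] //=; rewrite negb_and negbK => /orP[].
  by move=> /existsP[j /prefixP[v ->]]; exists [::], j, v.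
by move=> /IH[u [j [v ->]]]; exists (a :: u), j, v.
Qed.

Section Model.
Variables (K : fieldType) (n l : nat).
Local Notation mon w := (@monom K n.+2 (FMonom w)).
Local Notation gen := (@gen K n.+2).
Local Notation x := (lx n).
Implicit Types b c j : 'I_n.+2.

(** Exchanging y and z turns the leading word y y, which would overlap itself when l = 0, into y z.
    For n = 0 this is the identity. *)
Definition swap b : 'I_n.+2 :=
  if b == ly n then lz n else if b == lz n then ly n else b.

(** The relators of the sum over b <> x of all l + 3 rotations of x^(l+1) b b', with b' = [swap b],
    sorted by first letter. *)
Definition model_rel j : freeAlg K n.+2 :=
  if j == x then
    \sum_(b | b != x) \sum_(i < l.+1)
      mon (nseq i x ++ [:: b; swap b] ++ nseq (l - i) x)
  else mon (swap j :: nseq l.+1 x) + mon (nseq l.+1 x ++ [:: swap j]).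

Definition model : freeAlg K n.+2 := \sum_j gen j * model_rel j.

Lemma swapK : involutive swap. Proof.
move=> b; rewrite /swap; case: (eqVneq b (ly n)) => [->|/negbTE by_].
  by case: eqP => // _; rewrite eqxx.
case: (eqVneq b (lz n)) => [->|/negbTE bz]; first by rewrite eqxx.
by rewrite by_ bz.
Qed.

Lemma swapx : swap x = x. Proof. by []. Qed.

Lemma swap_neq_x b : (swap b != x) = (b != x).
Proof. by rewrite -[x in LHS]swapx (inj_eq (inv_inj swapK)). Qed.

Lemma monom_rcons w j : mon w * gen j = mon (rcons w j).
Proof. by rewrite /gen monomM fmuE cats1. Qed.

Lemma delta_model j : delta j model = model_rel j.
Proof.
have -> : delta j model = \sum_i (if i == j then model_rel i else 0).
  by rewrite /model /delta linear_sum; apply: eq_bigr => i _; exact: delta_gen.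
by rewrite -big_mkcond big_pred1_eq.
Qed.

Lemma model_order : order_ge l.+3 model.
Proof.
apply: order_ge_sum => j _; rewrite -[l.+3]add1n.
apply: order_geM; first by rewrite /gen fmuE; apply: order_ge_monom.
rewrite /model_rel; case: ifP => _.
  apply: order_ge_sum => b _; apply: order_ge_sum => i _.
  apply: order_ge_monom; rewrite /= size_cat /= !size_nseq; have := ltn_ord i; lia.
apply: order_geD; apply: order_ge_monom; rewrite /= ?size_cat ?size_nseq //=.
by rewrite addn1.
Qed.

Lemma sum_ord_shift (R : nmodType) m (U : nat -> R) v :
  \sum_(i < m) U i + (v + U m) = \sum_(i < m) U i.+1 + (v + U 0%N).
Proof.
rewrite !(addrCA _ v); congr (v + _).
have <- : \sum_(i < m.+1) U i = \sum_(i < m) U i + U m by rewrite big_ord_recr.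
by rewrite big_ord_recl addrC.
Qed.

Lemma model_cyclic : cyclicly_invariant model.
Proof.
(* [W b i] are the rotations keeping b and b' adjacent; [V b] is the rotation with them at opposite
   ends. [cyc] shifts i by one, and the remaining terms match after reindexing by [swap]. *)
pose W b i := mon (nseq i x ++ [:: b; swap b] ++ nseq (l.+1 - i) x).
pose V b := mon (b :: rcons (nseq l.+1 x) (swap b)).
have L : cyc model = \sum_(b | b != x) \sum_(i < l.+1) W b i +
    \sum_(b | b != x) (V (swap b) + W (swap b) l.+1).
  have -> : cyc model = \sum_j model_rel j * gen j.
    by rewrite /model /cyc linear_sum; apply: eq_bigr => j _; exact: cyc_gen.
  rewrite (bigD1 x) //=; congr (_ + _).
    rewrite /model_rel eqxx mulr_suml; apply: eq_bigr => b _.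
    rewrite mulr_suml; apply: eq_bigr => i _; rewrite monom_rcons /W.
    have := ltn_ord i; rewrite ltnS => il.
    rewrite subSn // -cats1 -!catA; congr (mon (_ ++ _ :: _ :: _)).
    by rewrite -[[:: x]]/(nseq 1 x) -nseqD addn1.
  apply: eq_bigr => b /negbTE bx; rewrite /model_rel bx.
  apply: (etrans (mulrDl _ _ _)).
  apply: (etrans (congr2 +%R (monom_rcons _ _) (monom_rcons _ _))).
  by rewrite /V /W swapK subnn; congr (_ + mon _); rewrite -cats1 -catA.
have R : model = \sum_(b | b != x) \sum_(i < l.+1) W b i.+1 +
    \sum_(b | b != x) (V b + W b 0%N).
  have e1 : gen x * model_rel x = \sum_(b | b != x) \sum_(i < l.+1) W b i.+1.
    rewrite /model_rel eqxx; apply: etrans (mulr_sumr _ _ _ _) _.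
    apply: eq_bigr => b _; apply: etrans (mulr_sumr _ _ _ _) _.
    by apply: eq_bigr => i _; exact: esym (monom_cons _ _ _).
  have e2 : \sum_(j | j != x) gen j * model_rel j =
      \sum_(b | b != x) (V b + W b 0%N).
    apply: eq_bigr => b /negbTE bx; rewrite /model_rel bx.
    apply: (etrans (mulrDr _ _ _)).
    apply: (etrans (congr2 +%R (esym (monom_cons _ _ _)) (esym (monom_cons _ _ _)))).
    rewrite /V /W subn0 cats1; exact: addrC.
  have e3 : model = gen x * model_rel x + \sum_(j | j != x) gen j * model_rel j.
    by rewrite /model [LHS](bigD1 x).
  exact: etrans e3 (congr2 +%R e1 e2).
have re : \sum_(b | b != x) (V (swap b) + W (swap b) l.+1) =
    \sum_(b | b != x) (V b + W b l.+1).
  rewrite [RHS](reindex_inj (inv_inj swapK)) /=.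
  by apply: eq_bigl => b; rewrite swap_neq_x.
rewrite /cyclicly_invariant L re {}R -!big_split /=; apply: eq_bigr => b _.
exact: (sum_ord_shift _ (W b) (V b)).
Qed.

Lemma sumD1 (R : nmodType) (I : finType) (j : I) (P : pred I) (E : I -> R) :
  P j -> \sum_(i | P i) E i = E j + \sum_(i | P i && (i != j)) E i.
Proof. exact: bigD1. Qed.

(** For c <> x, x^(l+1) c exceeds c x^(l+1) because x is the largest letter. For c = x, the latest
    first occurrence of a letter other than x and the largest such letter give i = l and b = y. *)
Lemma model_rel_lead c : exists (I : finType) (P : pred I) (f : I -> seq 'I_n.+2),
  model_rel (swap c) = mon (lead l c) + \sum_(i | P i) mon (f i) /\
  forall i, P i -> size (f i) = l.+2 /\ (code (f i) < code (lead l c))%N.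
Proof.
have [->|cx] := eqVneq c x; last first.
  exists unit, predT, (fun=> c :: nseq l.+1 x); split.
    rewrite /model_rel (negbTE (_ : swap c != x)) ?swap_neq_x // swapK.
    have e1 : mon (nseq l.+1 x ++ [:: c]) = mon (lead l c).
      by congr (mon _); rewrite lead_neq_x // -(addn1 l) nseqD -catA.
    have e2 : mon (c :: nseq l.+1 x) = \sum_(i : unit) mon (c :: nseq l.+1 x).
      by rewrite (big_pred1 tt) // => -[].
    exact: etrans (addrC _ _) (congr2 +%R e1 e2).
  move=> _ _; split; first by rewrite /= size_nseq.
  rewrite lead_neq_x //.
  have -> : nseq l x ++ [:: x; c] = x :: (nseq l x ++ [:: c]).
    by rewrite -[[:: x; c]]/([:: x] ++ [:: c]) catA -[[:: x]]/(nseq 1 x) -nseqD addn1.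
  apply: (code_lex [::]); first by rewrite size_cat /= !size_nseq addn1.
  by rewrite lt0n; move: cx; rewrite -(inj_eq val_inj).
pose f (p : 'I_n.+2 * 'I_l.+1) := nseq p.2 x ++ [:: p.1; swap p.1] ++ nseq (l - p.2) x.
exists ('I_n.+2 * 'I_l.+1)%type, (fun p => (p.1 != x) && (p != (ly n, ord_max))), f.
split.
  rewrite swapx /model_rel eqxx pair_big_dep /=.
  rewrite (eq_bigl (fun p : 'I_n.+2 * 'I_l.+1 => p.1 != x)); last first.
    by move=> p; rewrite andbT.
  have e : f (ly n, ord_max) = lead l x.
    by rewrite /f /= subnn /swap eqxx leadx.
  apply: etrans (sumD1 (j := (ly n, ord_max)) (P := fun p => p.1 != x)
    (fun p => mon (f p)) isT) _.
  exact: (congr1 (fun w => mon w + _) e).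
move=> -[b i] /= /andP[bx bi]; have il : (i <= l)%N by rewrite -ltnS.
split; first by rewrite /f size_cat /= !size_nseq; lia.
have b0 : (0 < b)%N by rewrite lt0n; move: bx; rewrite -(inj_eq val_inj).
rewrite leadx /f /=; have [lt|ge] := ltnP i l.
  have -> : nseq l x ++ [:: ly n; lz n] =
      nseq i x ++ x :: (nseq (l - i.+1) x ++ [:: ly n; lz n]).
    by rewrite -[in LHS](subnKC lt) addSnnS nseqD -catA.
  by apply: code_lex => //=; rewrite size_cat /= !size_nseq; lia.
have E : (i : nat) = l by lia.
rewrite E subnn; apply: code_lex => //.
rewrite /= /bump /=; move: bi.
rewrite xpair_eqE -[i == _](inj_eq val_inj) /= E eqxx andbT.
by rewrite -(inj_eq val_inj) /= /bump /=; lia.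
Qed.

Lemma sandwich_sum (R : pzRingType) (I : Type) (s : seq I) (P : pred I)
  (a b d : R) (E : I -> R) :
  a * (d + \sum_(i <- s | P i) E i) * b =
  a * d * b + \sum_(i <- s | P i) a * E i * b.
Proof. by rewrite mulrDr mulrDl mulr_sumr mulr_suml. Qed.

(** Rewriting leading words lowers the code and, the relators being homogeneous, keeps the length.
    The abstract [P] serves both for functionals vanishing on q and for membership in a span modulo
    the ideal. *)
Lemma normal_span (P : freeAlg K n.+2 -> Prop) m :
  (forall (t : K) p q, P p -> P q -> P (t *: p + q)) ->
  (forall q, pot_ideal model q -> P q) ->
  (forall w, normal l w -> size w = m -> P (mon w)) ->
  forall w, size w = m -> P (mon w).
Proof.
move=> PL PI PN w; have [d] := ubnP (code w).
elim: d w => // d IH w wd wm.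
have [/PN|] := boolP (normal l w); first exact.
move=> /not_normal_factor[u [c [v wE]]].
have [I [Q [f [rE fP]]]] := model_rel_lead c.
have [J0 JB hl hr] := pot_ideal_two_sided model.
have Pr : P (mon u * model_rel (swap c) * mon v).
  apply: PI; apply: hr; apply: hl; rewrite -delta_model; exact: pot_ideal_delta.
pose S := \sum_(i | Q i) mon (u ++ f i ++ v).
have rS : mon u * model_rel (swap c) * mon v = mon w + S.
  rewrite rE; apply: etrans (sandwich_sum _ _ _ _ _ _) _; congr (_ + _).
    by rewrite !monomM wE catA.
  by apply: eq_bigr => i _; rewrite !monomM catA.
have P0 : P 0.
  by apply: PI.
have PS : P S.
  rewrite /S; elim/big_ind: _ => // [p q Pp Pq|i Qi].
    by rewrite -[p]scale1r; apply: PL.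
  have [sf cf] := fP i Qi; apply: IH.
    apply: leq_trans (_ : code w <= d)%N; last by rewrite -ltnS.
    by rewrite wE; apply: code_sandwich; rewrite ?size_lead.
  by rewrite -wm wE !size_cat sf size_lead.
have -> : mon w = (-1) *: S + mon u * model_rel (swap c) * mon v.
  by rewrite rS scaleN1r [mon w + S]addrC addKr.
exact: PL.
Qed.

Lemma separated_model D : separated l D model.
Proof.
move=> f /annihP[f1 f2] fN; apply: dcoef_inj => w; rewrite dcoef0.
have [wD|] := leqP (size w) D; last exact: f1.
rewrite -ev_monom; apply: (normal_span (P := fun q => ev f q = 0) (m := size w)) => //.
- by move=> c p q pE qE; rewrite evD evZ pE qE mulr0 addr0.
- by move=> u Nu uw; rewrite ev_monom fN // uw.
Qed.

Lemma growth_model D : (growth model D <= size (normal_words n l D.+1))%N.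
Proof.
set NW := normal_words n l D.+1.
have [e [free_e span_e]] := growthP model D.
apply: (lin_indep_le (f := fun i : 'I_(size NW) =>
  pot_pi model (mon (nth [::] NW i))) free_e) => i.
pose P q := exists c : 'I_(size NW) -> K,
  pot_pi model q = \sum_i c i *: pot_pi model (mon (nth [::] NW i)).
have PL (t : K) p q : P p -> P q -> P (t *: p + q).
  move=> [a pE] [b qE]; exists (fun i => t * a i + b i).
  rewrite linearP /= pE qE scaler_sumr -big_split; apply: eq_bigr => j _.
  by rewrite scalerDl scalerA.
have PI q : pot_ideal model q -> P q.
  move=> Iq; exists (fun=> 0); rewrite big1 => [|j _]; last by rewrite scale0r.
  rewrite -(raddf0 (pot_pi model)); apply/pot_piP; by rewrite subr0.
have Pmon w : (size w <= D)%N -> P (mon w).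
  move=> wD; apply: (normal_span (P := P) (m := size w)) => // u Nu uw.
  have uN : u \in NW by rewrite mem_normal_words uw ltnS wD.
  have usz : (index u NW < size NW)%N by rewrite index_mem.
  exists (fun k => (k == Ordinal usz)%:R); rewrite (bigD1 (Ordinal usz)) //=.
  rewrite eqxx scale1r nth_index // big1 ?addr0 // => j /negbTE ->.
  by rewrite scale0r.
have [q qD <-] : @filtration K n.+2 model D (e i).
  rewrite span_e /=; exists (fun k => (k == i)%:R).
  rewrite (bigD1 i) //= eqxx scale1r big1 ?addr0 // => j /negbTE ->.
  by rewrite scale0r.
suff : P q by [].
have P0 : P 0 by apply: PI; have [] := pot_ideal_two_sided model.
rewrite (freeAlgE q) big_seq; elim/big_ind: _ => // [p r Pp Pr|w wq].
  by rewrite -[p]scale1r; apply: PL.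
by rewrite -[_ *: _]addr0; apply: PL => //; apply: Pmon; apply: qD.
Qed.

End Model.

(** The reverse inequality is the dimension recursion for the model. The count involves no field, so
    the model over [rat] can be used. *)
Lemma size_normal_words_recE n l d : (0 < l + n)%N ->
  (size (normal_words n l d.+1) + n.+2 * size (normal_words n l (d - l.+1)) =
   1 + n.+2 * size (normal_words n l d) + size (normal_words n l (d - l.+2)))%N.
Proof.
move=> ln; apply/eqP; rewrite eqn_leq size_normal_words_rec // andTb.
have Ml : order_ge l.+3 (model rat n l) by exact: model_order.
have Mc : cyclicly_invariant (model rat n l) by exact: model_cyclic.
have Ms : separated l d (model rat n l) by exact: separated_model.
have dimE i (id : (i <= d.+1)%N) := dim_annihE ln Ml Mc Ms id.
rewrite -(dimE d.+1 (leqnn _)); apply: dim_annih_normal_rec => // i id.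
by apply: dimE; apply: leqW.
Qed.

(** * Growth of the number of normal words *)

Section Recurrence.
Local Open Scope nat_scope.
Variables (N L : nat) (a : nat -> nat).
Hypothesis a0 : a 0 = 0.
Hypothesis rec : forall d, a d.+1 + N * a (d - L) = 1 + N * a d + a (d - L.+1).

Lemma ratio_pow p q d : (forall i, i < d -> p * a i <= q * a i.+1) ->
  forall m, p ^ m * a (d - m) <= q ^ m * a d.
Proof.
move=> h; elim=> [|m IH]; first by rewrite subn0 !expn0 !mul1n.
have [md|dm] := ltnP m d; last first.
  by have -> : d - m.+1 = 0; [lia | rewrite a0 muln0].
have := h (d - m.+1); rewrite -subSn // subSS => /(_ ltac:(lia)) hm.
rewrite !expnS; nia.
Qed.

(** By induction a (d - L) <= a d / 2^L, so a (d + 1) >= N (1 - 2^(-L)) a d, and this factor is at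
    least 2: it is 9/4 for N = 3, L = 2. *)
Lemma ratio2 : 0 < L -> (3 < N) || ((2 < N) && (1 < L)) ->
  forall d, 2 * a d <= a d.+1.
Proof.
move=> L0 NL d; elim/ltn_ind: d => d IH.
have h m : 2 ^ m * a (d - m) <= a d.
  have hp i : i < d -> 2 * a i <= 1 * a i.+1 by rewrite mul1n; apply: IH.
  by have := ratio_pow hp m; rewrite exp1n mul1n.
have hL := h L; have := rec d.
have [N3|N3] := ltnP 3 N.
  have : 2 * a (d - L) <= a d.
    by apply: leq_trans hL; rewrite leq_mul2r -{1}(expn1 2) leq_exp2l // L0 orbT.
  nia.
have L1 : 1 < L by move: NL; rewrite ltnNge N3 /= => /andP[].
have N3' : N = 3 by move: NL; lia.
have : 4 * a (d - L) <= a d.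
  by apply: leq_trans hL; rewrite leq_mul2r (leq_exp2l 2 L (ltnSn 1)) L1 orbT.
rewrite N3'; lia.
Qed.

Hypothesis a_homo : {homo a : i j / i <= j}.

(** For L >= 4 the loss 2 a (d - L) is at most 2 (2/3)^4 a d < a d / 2. For L = 3 this fails, but
    the last term of the recursion, at least (a (d - 3) - 1) / 2, leaves a loss of (3/2) (2/3)^3 a
    d. *)
Lemma ratio32 : N = 2 -> 2 < L -> (forall d, a d.+1 <= 1 + 2 * a d) ->
  forall d, 3 * a d <= 2 * a d.+1.
Proof.
move=> N2 L2 aS d; elim/ltn_ind: d => d IH.
have h := ratio_pow IH; have := rec d; rewrite N2.
have [L3|L3] := ltnP 3 L.
  have h1 : a (d - L) <= a (d - 4) by apply: a_homo; lia.
  by have := h 4; rewrite !expnS expn0; lia.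
have -> : L = 3 by lia.
have := h 3; rewrite !expnS expn0; have [d3|d3] := ltnP 3 d.
  have := aS (d - 4); have -> : (d - 4).+1 = d - 3 by lia.
  lia.
have -> : d - 3 = 0 by lia.
have -> : d - 4 = 0 by lia.
rewrite a0; lia.
Qed.

(** The series is 1/(1 - t)^3, summed once more. Small indices are separate because of truncated
    subtraction. *)
Lemma cubic_n3 : N = 3 -> L = 1 -> forall i, 6 * a i = i * i.+1 * i.+2.
Proof.
move=> N3 L1; elim/ltn_ind => -[|d] IH; first by rewrite a0.
have := rec d; rewrite N3 L1; case: d IH => [|[|d]] IH.
- by rewrite a0; lia.
- by have := IH 1 (ltnSn 1); rewrite /= a0; lia.
rewrite !subSS !subn0.
have := IH d.+2; have := IH d.+1; have := IH d; rewrite !leqnn !ltnS ?leqW //.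
by move=> /(_ isT) h1 /(_ isT) h2 /(_ isT) h3; nia.
Qed.

(** Here 1 - 2t + 2t^3 - t^4 = (1 - t)^3 (1 + t); the root -1 produces the parity term. *)
Lemma cubic_n2 : N = 2 -> L = 2 ->
  forall i, 24 * a i = 2 * i ^ 3 + 9 * i ^ 2 + 10 * i + 3 * odd i.
Proof.
move=> N2 L1; elim/ltn_ind => -[|d] IH; first by rewrite a0.
have := rec d; rewrite N2 L1; case: d IH => [|[|[|d]]] IH.
- by rewrite a0; lia.
- by have := IH 1 isT; rewrite /= a0; lia.
- by have := IH 2 isT; rewrite /= a0; lia.
rewrite !subSS !subn0.
have := IH d.+3; have := IH d.+1; have := IH d; rewrite !leqnn !ltnS ?leqW //.
move=> /(_ isT) h1 /(_ isT) h2 /(_ isT) h3 h.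
move: h h1 h2 h3; move: (a d.+4) (a d.+3) (a d.+1) (a d) => a4 a3 a1 b0.
by rewrite /= !negbK; case: (odd d) => /=; rewrite !expnS !expn0; lia.
Qed.

End Recurrence.

Section NormalWordsGrowth.
Local Open Scope nat_scope.
Variables n l : nat.
Hypothesis ln : 0 < l + n.
Local Notation nu i := (size (normal_words n l i)).

Let rec d : nu d.+1 + n.+2 * nu (d - l.+1) = 1 + n.+2 * nu d + nu (d - l.+2).
Proof. exact: size_normal_words_recE. Qed.

Lemma normal_words_homo : {homo (fun i => nu i) : i j / i <= j}.
Proof.
move=> i j ij; apply: uniq_leq_size; first exact: uniq_normal_words.
move=> w; rewrite !mem_normal_words => /andP[wi ->]; rewrite andbT.
exact: leq_trans ij.
Qed.

Lemma normal_words_exponential : (1 < n) || ((0 < n) && (0 < l)) || (1 < l) ->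
  forall j, 3 ^ j <= 2 ^ j * nu j.+1.
Proof.
move=> nl; suff h d : 3 * nu d <= 2 * nu d.+1.
  elim=> [|j IH]; first by rewrite /= size_filter.
  by have := h j.+1; rewrite !expnS; nia.
have [n0|n0] := posnP n.
  apply: (ratio32 (L := l.+1) erefl rec normal_words_homo); rewrite ?n0 //.
    by move: nl; rewrite n0 /=; lia.
  by move=> i; have := size_normal_wordsS n l i; rewrite n0.
have := ratio2 (a := fun i => nu i) (L := l.+1) erefl rec (ltn0Sn l) _ d.
move=> /(_ ltac:(lia)); lia.
Qed.

(** The constant 12 comes from the leading term 2 i^3 / 24 in the two-letter case. *)
Lemma normal_words_cubic : (n = 0 /\ l = 1) \/ (n = 1 /\ l = 0) ->
  forall i, i ^ 3 <= 12 * nu i /\ nu i <= i ^ 3.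
Proof.
case=> -[nE lE] i.
  have := cubic_n2 (a := fun i => nu i) (L := l.+1) erefl rec _ _ i.
  rewrite nE lE => /(_ erefl erefl); move: (size _) => s.
  case: i => [|i]; first by rewrite /=; lia.
  by case: (odd _); rewrite !expnS expn0; nia.
have := cubic_n3 (a := fun i => nu i) (L := l.+1) erefl rec _ _ i.
rewrite nE lE => /(_ erefl erefl); move: (size _) => s.
by case: i => [|i]; rewrite !expnS expn0; nia.
Qed.

End NormalWordsGrowth.

(** * Growth rates *)

Section GrowthRates.
Variables (R : realType) (a : nat -> nat).

Lemma cvg_inv_ln_nat : (fun j : nat => (@ln R j%:R)^-1) @ \oo --> (0 : R).
Proof.
apply/gtr0_cvgV0.
  near=> j; apply: ln_gt0; rewrite (ltr_nat R 1 j).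
  by near: j; exact: nbhs_infty_gt.
apply/cvgryPgt => A; near=> j.
rewrite -(expRK A) ltr_ln ?posrE ?expR_gt0 //.
  by near: j; exact: nbhs_infty_gtr.
by rewrite ltr0n; near: j; exact: nbhs_infty_gt.
Unshelve. all: by end_near. Qed.

Lemma cvg_add_div_ln (c d : R) :
  (fun j : nat => c + d / ln (j%:R : R)) @ \oo --> c.
Proof.
rewrite -[X in _ --> X]addr0 -[X in _ --> _ + X](mulr0 d).
by apply: cvgD; [exact: cvg_cst | apply: cvgMr; exact: cvg_inv_ln_nat].
Qed.

Lemma growth_ratio_ge j : (1 < j)%N -> (j ^ 3 <= 12 * a j)%N ->
  3 + (- ln 12) / ln (j%:R : R) <= growth_ratio R a j.
Proof.
move=> j1 aj; have lnj : 0 < ln (j%:R : R) by rewrite ln_gt0 // (ltr_nat R 1 j).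
have j0 : 0 < (j%:R : R) by rewrite ltr0n; apply: ltnW.
have j3 : (0 < j ^ 3)%N by rewrite expn_gt0; case: j j1 {aj lnj j0}.
have a0 : 0 < (a j)%:R :> R by rewrite ltr0n; lia.
rewrite /growth_ratio ler_pdivlMr // mulrDl divfK ?gt_eqF //.
rewrite lerBlDr -lnM ?posrE // (mulr_natl (ln _) 3) -lnXn //.
rewrite ler_ln ?posrE ?exprn_gt0 ?mulr_gt0 // -natrX -natrM ler_nat; lia.
Qed.

Lemma growth_ratio_le j : (1 < j)%N -> (0 < a j <= j.+1 ^ 3)%N ->
  growth_ratio R a j <= 3 + (3 * ln 2) / ln (j%:R : R).
Proof.
move=> j1 /andP[aj0 aj].
have lnj : 0 < ln (j%:R : R) by rewrite ln_gt0 // (ltr_nat R 1 j).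
have j0 : 0 < (j%:R : R) by rewrite ltr0n; apply: ltnW.
have a0 : 0 < (a j)%:R :> R by rewrite ltr0n.
rewrite /growth_ratio ler_pdivrMr // mulrDl divfK ?gt_eqF // -mulrDr.
rewrite -lnM ?posrE // (mulr_natl (ln _) 3) -lnXn ?mulr_gt0 //.
rewrite ler_ln ?posrE ?exprn_gt0 ?mulr_gt0 // -natrM -natrX ler_nat.
(* The bound (2j)^3 absorbs the shift, as j + 1 <= 2j; this is the source of 3 ln 2. *)
by apply: leq_trans aj _; rewrite leq_exp2r //; lia.
Qed.

Lemma at_least_cubic_growthP : (forall j, j ^ 3 <= 12 * a j)%N ->
  at_least_cubic_growth R a.
Proof.
move=> aj; pose lo j := 3 + (- ln 12) / ln (j%:R : R).
have cvlo : (fun j => (lo j)%:E) @ \oo --> (3%:E : \bar R).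
  by apply: cvg_EFin; [near=> j | exact: cvg_add_div_ln].
rewrite /at_least_cubic_growth limn_einf_lim -(cvg_lim _ (cvg_einfs cvlo)) //.
apply: lee_lim; [exact: is_cvg_einfs|exact: is_cvg_einfs|].
near=> m; apply: le_ereal_inf_tmp => _ [k /= mk <-].
apply: (@le_trans _ _ (lo k)%:E); first by apply: ereal_inf_lbound; exists k.
rewrite lee_fin; apply: growth_ratio_ge => //; apply: leq_trans mk.
by near: m; exact: nbhs_infty_gt.
Unshelve. all: by end_near. Qed.

Lemma cubic_growthP : (forall j, j ^ 3 <= 12 * a j)%N ->
  (forall j, a j <= j.+1 ^ 3)%N -> cubic_growth R a.
Proof.
move=> aj ja; have H : \forall j \near \oo,
    3 + (- ln 12) / ln (j%:R : R) <= growth_ratio R a j <= 3 + (3 * ln 2) / ln (j%:R : R).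
  near=> j; have j1 : (1 < j)%N by near: j; exact: nbhs_infty_gt.
  rewrite growth_ratio_ge // growth_ratio_le // ja andbT.
  by have := aj j; have : (0 < j ^ 3)%N; [rewrite expn_gt0 (ltnW j1) | lia].
have lo := @cvg_add_div_ln 3 (- ln 12); have hi := @cvg_add_div_ln 3 (3 * ln 2).
have lim := squeeze_cvgr H lo hi; exact: lim.
Unshelve. all: by end_near. Qed.

End GrowthRates.

(** * Unbounded growth and the final assembly *)

Lemma infinite_dim_growth (K : fieldType) n (F : freeAlg K n) :
  (forall m, exists j, m < growth F j)%N -> ~ finite_dim [set: potAlg F].
Proof.
move=> unb [d [e [_ span_e]]]; have [j] := unb d; rewrite ltnNge => /negP; apply.
have [f [free_f _]] := growthP F j.
apply: (lin_indep_le free_f (f := e)) => i.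
by have : [set: potAlg F] (f i) by []; rewrite span_e.
Qed.

Lemma cube_unbounded (a : nat -> nat) : (forall j, j ^ 3 <= 12 * a j)%N ->
  forall m, exists j, (m < a j)%N.
Proof.
move=> aj m; exists (12 * m.+1)%N; have := aj (12 * m.+1)%N.
by rewrite !expnS expn0; nia.
Qed.

Lemma exponential_unbounded (a : nat -> nat) :
  (forall j, 3 ^ j <= 2 ^ j * a j)%N -> forall m, exists j, (m < a j)%N.
Proof.
move=> aj m; exists (2 * m.+1)%N; set j := (2 * m.+1)%N.
(* Bernoulli: (3/2)^i >= 1 + i/2, which is m + 2 at i = 2 (m + 1). *)
have h i : (2 ^ i * i.+2 <= 2 * 3 ^ i)%N.
  by elim: i => // i IH; rewrite !expnS; nia.
have := h j; have := aj j; have : (0 < 2 ^ j)%N by rewrite expn_gt0.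
by rewrite /j; nia.
Qed.

Lemma exponential_growthP (R : realType) (a : nat -> nat) :
  (forall j, 3 ^ j <= 2 ^ j * a j)%N -> exponential_growth R a.
Proof.
move=> aj; exists (3 / 2); first by lra.
move=> j; rewrite expr_div_n ler_pdivrMr ?exprn_gt0 //.
by rewrite -!natrX -natrM ler_nat mulnC.
Qed.

Theorem theorem1p12 (R : realType) (K : closedFieldType)
  (hK2 : 2%N \notin [pchar K]%R) (hK3 : 3%N \notin [pchar K]%R)
  (n k : nat) (hn : (2 <= n)%N) (hk : (3 <= k)%N) (hnk : (n, k) <> (2%N, 3%N)) :
  (forall F : freeAlg K n,
     cyclicly_invariant F ->
     (forall m, (m < k)%N -> hom_comp m F = 0%R) ->
     ~ finite_dim [set: potAlg F]%classic)
  /\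
  ((n, k) = (2%N, 4%N) \/ (n, k) = (3%N, 3%N) ->
     (forall F : freeAlg K n,
        cyclicly_invariant F ->
        (forall m, (m < k)%N -> hom_comp m F = 0%R) ->
        at_least_cubic_growth R (growth F))
     /\
     (exists F : freeAlg K n,
        [/\ cyclicly_invariant F,
            forall m, (m < k)%N -> hom_comp m F = 0%R &
            cubic_growth R (growth F)]))
  /\
  ((n, k) <> (2%N, 4%N) -> (n, k) <> (3%N, 3%N) ->
     forall F : freeAlg K n,
       cyclicly_invariant F ->
       (forall m, (m < k)%N -> hom_comp m F = 0%R) ->
       exponential_growth R (growth F)).
Proof.
case: n hn hnk => [|[|n]] // _ hnk; case: k hk hnk => [|[|[|l]]] // _ hnk.
(* With n + 2 letters and order l + 3, the excluded pair (2, 3) is l = n = 0. *)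
have ln : (0 < l + n)%N.
  by rewrite lt0n addn_eq0; apply/negP => /andP[/eqP l0 /eqP n0];
    apply: hnk; rewrite l0 n0.
have lower (F : freeAlg K n.+2) j : cyclicly_invariant F ->
    (forall m, (m < l.+3)%N -> hom_comp m F = 0%R) ->
    (size (normal_words n l j.+1) <= growth F j)%N.
  move=> Fc /hom_comp_order_ge Fl.
  apply: (growth_ge_normal_words (G := model K n l)) => //.
  - exact: model_order.
  - exact: model_cyclic.
  - exact: separated_model.
have cubic (F : freeAlg K n.+2) : cyclicly_invariant F ->
    (forall m, (m < l.+3)%N -> hom_comp m F = 0%R) ->
    (n = 0 /\ l = 1)%N \/ (n = 1 /\ l = 0)%N ->
    forall j, (j ^ 3 <= 12 * growth F j)%N.
  move=> Fc Fl nl j; have [h _] := normal_words_cubic ln nl j.+1.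
  have := lower F j Fc Fl; have : (j ^ 3 <= j.+1 ^ 3)%N by rewrite leq_exp2r.
  lia.
have expo (F : freeAlg K n.+2) : cyclicly_invariant F ->
    (forall m, (m < l.+3)%N -> hom_comp m F = 0%R) ->
    ~ ((n = 0 /\ l = 1)%N \/ (n = 1 /\ l = 0)%N) ->
    forall j, (3 ^ j <= 2 ^ j * growth F j)%N.
  move=> Fc Fl nl j; apply: leq_trans (leq_mul (leqnn _) (lower F j Fc Fl)).
  by apply: normal_words_exponential => //; lia.
have cases : (n.+2, l.+3) = (2%N, 4%N) \/ (n.+2, l.+3) = (3%N, 3%N) <->
    (n = 0 /\ l = 1)%N \/ (n = 1 /\ l = 0)%N.
  by split=> -[[-> ->]|[-> ->]]; [left|right|left|right].
split; [|split].
- move=> F Fc Fl; apply: infinite_dim_growth.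
  have [nl|nl] := pselect ((n = 0 /\ l = 1)%N \/ (n = 1 /\ l = 0)%N).
    exact: cube_unbounded (cubic F Fc Fl nl).
  exact: exponential_unbounded (expo F Fc Fl nl).
- move=> /cases nl; split=> [F Fc Fl|].
    by apply: at_least_cubic_growthP; exact: cubic.
  have Mc := @model_cyclic K n l.
  have Ml : forall m, (m < l.+3)%N -> hom_comp m (model K n l) = 0.
    by apply/hom_comp_order_ge; exact: model_order.
  exists (model K n l); split=> //; apply: cubic_growthP => j.
    exact: cubic.
  have [_ h] := normal_words_cubic ln nl j.+1.
  exact: leq_trans (growth_model K n l j) h.
- move=> n24 n33 F Fc Fl; apply: exponential_growthP; apply: expo => //.
  by move=> /cases[].
Qed.
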